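(* Let $k$ be a nonnegative locally integrable function on $(0,\infty)$ whose Laplace transform $\tilde k(p)=\int_0^\infty e^{-pt}k(t)\,dt$ exists for all $p>0$, and assume that $\tilde k$ is a Stieltjes function satisfying $\tilde k(p)\to\infty$ as $p\to 0$, $\tilde k(p)\to 0$ as $p\to\infty$, $p\tilde k(p)\to 0$ as $p\to 0$, and $p\tilde k(p)\to\infty$ as $p\to\infty$. Let $\varkappa$ be the function on $(0,\infty)$ (defined in the context) whose Laplace transform is $1/(p\tilde k(p))$. Define $$(\mathbb D_{(k)}u)(t)=\frac{d}{dt}\int_0^t k(t-\tau)u(\tau)\,d\tau-k(t)u(0),\qquad (\mathbb I_{(k)}f)(t)=\int_0^t\varkappa(t-s)f(s)\,ds .$$ Then: (i) If $f$ is a locally bounded measurable function on $(0,\infty)$, then $\mathbb D_{(k)}\mathbb I_{(k)}f=f$. (ii) If a function $u$ is absolutely continuous on $[0,\infty)$, then $(\mathbb I_{(k)}\mathbb D_{(k)}u)(t)=u(t)-u(0)$.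
   Context: A Stieltjes function is a function $\varphi$ on $(0,\infty)$ of the form $\varphi(\lambda)=\frac{a}{\lambda}+b+\int_0^\infty\frac{1}{\lambda+t}\,\sigma(dt)$ with $a,b\ge 0$ and $\sigma$ a Borel measure on $[0,\infty)$ with $\int_0^\infty(1+t)^{-1}\sigma(dt)<\infty$. Under the stated assumptions on $k$, the function $p\mapsto 1/(p\tilde k(p))$ is a Stieltjes function which can be written as $\int_0^\infty e^{-ps}\varkappa(s)\,ds$ for a completely monotone function $\varkappa$ on $(0,\infty)$; this $\varkappa$ is the kernel used in $\mathbb I_{(k)}$. The operator $\mathbb D_{(k)}$ is applied to continuous functions $u$ for which $k*u$ is almost everywhere differentiable, and $\mathbb I_{(k)}$ is defined on locally integrable functions. *)

(* Defs.v *)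
From HB Require Import structures.
From mathcomp Require Import all_boot all_order all_algebra.
From mathcomp Require Import all_classical all_reals all_analysis.
Set Implicit Arguments. Unset Strict Implicit. Unset Printing Implicit Defensive.
Import Order.TTheory GRing.Theory Num.Theory.
Import numFieldNormedType.Exports.
Local Open Scope classical_set_scope.
Local Open Scope ring_scope.

Section Defs.
Context {R : realType}.
Local Notation mu := (@lebesgue_measure R).

(* Stieltjes function on (0,oo): phi(l) = a/l + b + \int_[0,oo) sigma(dt)/(l+t),
   with a,b >= 0, sigma a Borel measure (only its restriction to [0,oo) matters)
   and \int_[0,oo) (1+t)^-1 sigma(dt) < oo. *)
Definition stieltjes (phi : R -> R) : Prop :=
  exists (a b : R) (sigma : {measure set R -> \bar R}),
    [/\ 0 <= a, 0 <= b,
        (\int[sigma]_(t in `[0%R, +oo[) ((1 + t)^-1)%:E < +oo)%E &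
        forall l : R, 0 < l ->
          (phi l)%:E = ((a / l + b)%:E + \int[sigma]_(t in `[0%R, +oo[) ((l + t)^-1)%:E)%E].

Definition loc_integrable (g : R -> R) : Prop :=
  forall T : R, 0 < T -> mu.-integrable `]0, T] (fun t => (g t)%:E).

Definition laplace_exists (g : R -> R) (p : R) : Prop :=
  mu.-integrable `]0, +oo[ (fun t => (expR (- (p * t)) * g t)%:E).

Definition laplace (g : R -> R) (p : R) : R :=
  Rintegral mu `]0, +oo[ (fun t => expR (- (p * t)) * g t).

Definition kconv (g u : R -> R) (t : R) : R :=
  Rintegral mu `[0, t] (fun s => g (t - s) * u s).

Definition Dk (k u : R -> R) (t : R) : R :=
  derive1 (kconv k u) t - k t * u 0.

Definition Ik (varkappa f : R -> R) (t : R) : R := kconv varkappa f t.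

Definition loc_bounded (f : R -> R) : Prop :=
  forall T : R, 0 < T -> exists M : R, forall s, 0 < s <= T -> `|f s| <= M.

Definition abs_cont_on (u : R -> R) (a b : R) : Prop :=
  forall eps : R, 0 < eps -> exists2 delta : R, 0 < delta &
    forall (n : nat) (x y : nat -> R),
      (forall i, (i < n)%N -> a <= x i /\ x i <= y i /\ y i <= b) ->
      (forall i j, (i < j < n)%N -> y i <= x j) ->
      \sum_(i < n) (y i - x i) < delta ->
      \sum_(i < n) `|u (y i) - u (x i)| < eps.

Definition abs_cont_nonneg (u : R -> R) : Prop :=
  forall T : R, 0 < T -> abs_cont_on u 0 T.

End Defs.

(* Main.v *)
Require Import Defs.
From HB Require Import structures.
From mathcomp Require Import all_boot all_order all_algebra.
From mathcomp Require Import all_classical all_reals all_analysis.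
From mathcomp Require Import measurable_realfun.
From mathcomp Require Import ring lra.
Import Order.TTheory GRing.Theory Num.Theory.
Import numFieldNormedType.Exports.
Local Open Scope classical_set_scope.
Local Open Scope ring_scope.

(** By Tonelli both parts reduce to the Sonine identity [k * varkappa = 1] almost
    everywhere on [(0, oo)], which holds because both sides have the Laplace
    transform [1 / p].  In (i), [k * (varkappa * f)] is then the primitive of
    [f], at every point since [f] is locally bounded.  In (ii), [D_k u] equals
    [k * u'] almost everywhere, and [varkappa * (k * u') = 1 * u'].

    For (ii) to hold at every [t], and not just almost everywhere, the integral
    of [|varkappa| * k * |u'|] has to converge at every [t]; this needs
    [varkappa >= 0].  If [phi] is the Stieltjes function [laplace k], then
    [B p = p * phi p] has completely monotone increments, being a combination
    of [1], [p] and [p / (p + t)], so [laplace varkappa = 1 / B] is completely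
    monotone.  A function with a completely monotone Laplace transform is
    nonnegative almost everywhere: testing it against Bernstein polynomials in
    [exp (- t)] of the indicator of an interval shows that its integrals over
    intervals are nonnegative.  Only the values of the Laplace transform at the
    positive integers matter, so complete monotonicity is used in the discrete
    form of Hausdorff's moment problem. *)

(** * Integrals of functions that agree almost everywhere *)

Section IntegralAe.
Local Open Scope ereal_scope.
Context d (T : measurableType d) (R : realType) (mu : {measure set T -> \bar R}).

Import HBNNSimple.

(** The integral of [f] is a supremum over simple functions below [f]. Such a function, set to zero
    on the measurable null set [N], keeps its integral and lies below [g] everywhere. *)
Lemma nnintegral_ae_le (f g : T -> \bar R) :
  (forall x, 0 <= f x) -> (forall x, 0 <= g x) ->
  {ae mu, forall x, f x = g x} -> \int[mu]_x f x <= \int[mu]_x g x.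
Proof.
move=> f0 g0 [N [mN N0 fgN]].
rewrite ge0_integralTE//; apply: ge_ereal_sup => _ [h hf <-].
have mC : measurable (~` N) by exact: measurableC.
pose h' := proj_nnsfun h mC.
have h'E x : h' x = (h x * \1_(~` N) x)%R by [].
have h'g x : (h' x)%:E <= g x.
  rewrite h'E indicE; case: (boolP (x \in ~` N)) => [|_]; last first.
    by rewrite mulr0.
  rewrite inE => /= xN; rewrite mulr1 (le_trans (hf x))//.
  suff -> : f x = g x by [].
  by apply: contrapT => fgx; apply: xN; exact: fgN.
rewrite -integralT_nnsfun.
have -> : \int[mu]_x (h x)%:E = \int[mu]_x (h' x)%:E.
  apply: ge0_ae_eq_integral => //.
  - exact/measurable_EFinP.
  - exact/measurable_EFinP.
  - by move=> x _; rewrite lee_fin.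
  - by move=> x _; rewrite lee_fin.
  exists N; split => // x /= nx; apply: contrapT => xN; apply: nx => _.
  by rewrite /= mindicE mem_set// mulr1.
rewrite integralT_nnsfun ge0_integralTE//; apply: ereal_sup_ubound.
by exists h'.
Qed.

Lemma ae_impl (P Q : T -> Prop) : (forall x, P x -> Q x) ->
  {ae mu, forall x, P x} -> {ae mu, forall x, Q x}.
Proof. by move=> PQ; apply: filterS. Qed.

Lemma ae_impl2 (P Q S : T -> Prop) : (forall x, P x -> Q x -> S x) ->
  {ae mu, forall x, P x} -> {ae mu, forall x, Q x} -> {ae mu, forall x, S x}.
Proof. by move=> PQ; apply: filterS2. Qed.

Lemma ae_and (P Q : T -> Prop) : {ae mu, forall x, P x} ->
  {ae mu, forall x, Q x} -> {ae mu, forall x, P x /\ Q x}.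
Proof. exact: ae_impl2. Qed.

(* No measurability is needed, because the integral of a nonnegative function
   is a supremum over the simple functions below it. *)
Lemma integral_ae (D : set T) (f g : T -> \bar R) :
  {ae mu, forall x, D x -> f x = g x} ->
  \int[mu]_(x in D) f x = \int[mu]_(x in D) g x.
Proof.
move=> fg.
have fgD : {ae mu, forall x, (f \_ D) x = (g \_ D) x}.
  apply: filterS fg => x fgx; rewrite !patchE; case: ifPn => //.
  by rewrite inE => /fgx.
rewrite integral_mkcond [RHS]integral_mkcond [LHS]integralE [RHS]integralE.
by congr (_ - _); apply/eqP; rewrite eq_le; apply/andP; split;
  apply: nnintegral_ae_le => //;
  apply: filterS fgD => x; rewrite !(funeposE, funenegE) => ->.
Qed.

End IntegralAe.
Arguments ae_and {d T R mu P Q}.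

(** * Convolution of nonnegative functions *)

Section Convolution.
Local Open Scope ereal_scope.
Context {R : realType}.
Local Notation mu := (@lebesgue_measure R).
Implicit Types F G H : R -> \bar R.

Lemma measurable_subl (t : R) : measurable_fun [set: R] (fun x : R => t - x)%R.
Proof. exact: measurable_funB. Qed.

(** Naming the reflection lets it carry a structure of measurable function, so that its pushforward
    is a measure. *)
Definition subl (t : R) (x : measurableTypeR R) : measurableTypeR R := (t - x)%R.

HB.instance Definition _ (t : R) := isMeasurableFun.Build _ _
  (measurableTypeR R) (measurableTypeR R) (subl t) (measurable_subl t).

(** By uniqueness of Lebesgue measure only half-open intervals need checking, and a reflection
    preserves their length. *)
Lemma lebesgue_measure_subl (t : R) (A : set R) : measurable A ->
  pushforward mu (subl t) A = mu A.
Proof.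
move=> mA; apply/esym/lebesgue_measure_unique => //= _ [[a b]] _ <-.
rewrite /pushforward /=.
have -> : subl t @^-1` `]a, b] = `[(t - b)%R, (t - a)%R[%classic.
  apply/seteqP; split => x /=; rewrite /subl !in_itv/=.
    by move=> /andP[? ?]; apply/andP; split; lra.
  by move=> /andP[? ?]; apply/andP; split; lra.
rewrite !lebesgue_measure_itv/= !lte_fin ltrD2l ltrN2.
by case: ifPn => // _; rewrite -!EFinB; congr EFin; ring.
Qed.

Lemma integral_subl F (t : R) : measurable_fun setT F -> (forall x, 0 <= F x) ->
  \int[mu]_x F (t - x)%R = \int[mu]_x F x.
Proof.
move=> mF F0; have /= := @ge0_integral_pushforward _ _ (measurableTypeR R)
  (measurableTypeR R) R (subl t) (measurable_subl t) mu setT F measurableT mF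
  (fun x _ => F0 x).
rewrite preimage_setT => <-.
by apply: eq_measure_integral => A mA _; exact: lebesgue_measure_subl.
Qed.

Lemma ae_subl (P : R -> Prop) (t : R) :
  {ae mu, forall x, P x} -> {ae mu, forall x, P (t - x)%R}.
Proof.
move=> [N [mN N0 PN]]; exists ((fun x => t - x)%R @^-1` N); split.
- by rewrite -(setTI (_ @^-1` _)); exact: measurable_subl.
- by have := lebesgue_measure_subl t _ mN; rewrite N0.
- by move=> x /= nP; exact: PN.
Qed.

(** For functions vanishing on the left half-line this is the Volterra convolution. With extended
    nonnegative values, Tonelli's theorem gives its algebra without integrability conditions. *)
Definition conv F G (t : R) := \int[mu]_s (F (t - s)%R * G s).

Lemma conv_ge0 F G t : (forall x, 0 <= F x) -> (forall x, 0 <= G x) ->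
  0 <= conv F G t.
Proof. by move=> F0 G0; apply: integral_ge0 => x _; exact: mule_ge0. Qed.

Lemma measurable_convprod F G : measurable_fun setT F -> measurable_fun setT G ->
  measurable_fun setT (fun z : R * R => F (z.1 - z.2)%R * G z.2).
Proof.
move=> mF mG; apply: emeasurable_funM; last exact: measurableT_comp.
by apply: (measurableT_comp mF); exact: measurable_funB.
Qed.

Lemma measurable_conv F G : measurable_fun setT F -> measurable_fun setT G ->
  (forall x, 0 <= F x) -> (forall x, 0 <= G x) -> measurable_fun setT (conv F G).
Proof.
move=> mF mG F0 G0.
apply: (@measurable_fun_fubini_tonelli_F _ _ _ _ _ mu
  (fun z : R * R => F (z.1 - z.2)%R * G z.2)).
- exact: measurable_convprod.
- by move=> x; exact: mule_ge0.
Qed.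

Lemma convC F G t : measurable_fun setT F -> measurable_fun setT G ->
  (forall x, 0 <= F x) -> (forall x, 0 <= G x) -> conv F G t = conv G F t.
Proof.
move=> mF mG F0 G0; rewrite /conv -(integral_subl _ t)//; last 2 first.
- by apply: emeasurable_funM => //; apply: measurableT_comp mF (measurable_subl t).
- by move=> x; exact: mule_ge0.
by apply: eq_integral => s _; rewrite opprB addrC subrK muleC.
Qed.

Lemma integral_conv F G : measurable_fun setT F -> measurable_fun setT G ->
  (forall x, 0 <= F x) -> (forall x, 0 <= G x) ->
  \int[mu]_t conv F G t = (\int[mu]_t F t) * \int[mu]_t G t.
Proof.
move=> mF mG F0 G0; rewrite /conv.
rewrite (@fubini_tonelli _ _ _ _ _ mu mu
  (fun z : R * R => F (z.1 - z.2)%R * G z.2))//=; last 2 first.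
- exact: measurable_convprod.
- by move=> x; exact: mule_ge0.
rewrite -ge0_integralZl//; last first.
  exact: integral_ge0.
apply: eq_integral => s _.
rewrite ge0_integralZr//; last first.
  by apply: measurableT_comp mF _; exact: measurable_funB.
(* Translation invariance comes from two reflections, about [0] and then about [s]. *)
congr (_ * _); rewrite -[RHS](integral_subl _ 0)//.
rewrite -[RHS](integral_subl _ s)//.
  by apply: eq_integral => x _; congr F; ring.
by apply: measurableT_comp mF _; exact: measurable_subl.
Qed.

Lemma convA F G H t :
  measurable_fun setT F -> measurable_fun setT G -> measurable_fun setT H ->
  (forall x, 0 <= F x) -> (forall x, 0 <= G x) -> (forall x, 0 <= H x) ->
  conv F (conv G H) t = conv (conv F G) H t.
Proof.
move=> mF mG mH F0 G0 H0; rewrite /conv.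
transitivity (\int[mu]_s \int[mu]_r (F (t - s)%R * G (s - r)%R * H r)).
  apply: eq_integral => s _; rewrite -ge0_integralZl//.
  - by apply: eq_integral => r _; rewrite muleA.
  - apply: emeasurable_funM => //.
    exact: measurableT_comp mG (measurable_subl s).
  - by move=> r _; exact: mule_ge0.
rewrite (@fubini_tonelli _ _ _ _ _ mu mu
  (fun z : R * R => F (t - z.1)%R * G (z.1 - z.2)%R * H z.2))//=; last 2 first.
- apply: emeasurable_funM; last exact: measurableT_comp.
  apply: emeasurable_funM.
    by apply: (measurableT_comp mF); exact: measurable_funB.
  by apply: (measurableT_comp mG); exact: measurable_funB.
- by move=> x; rewrite !mule_ge0.
apply: eq_integral => r _.
have m1 : measurable_fun setT (fun s : R => F (t - s)%R * G (s - r)%R).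
  apply: emeasurable_funM; first exact: measurableT_comp mF (measurable_subl t).
  by apply: measurableT_comp mG _; exact: measurable_funB.
rewrite ge0_integralZr//; last by move=> s _; exact: mule_ge0.
congr (_ * _).
(* Reflecting by [t] on the left and by [t - r] on the right brings both sides to the integral of
   [F s * G (t - r - s)]. *)
rewrite -[LHS](integral_subl _ (t - r + r)%R)//; last first.
  by move=> s; exact: mule_ge0.
have m2 : measurable_fun setT (fun s : R => F s * G (t - r - s)%R).
  by apply: emeasurable_funM => //; exact: measurableT_comp mG (measurable_subl _).
rewrite -[RHS](integral_subl _ (t - r)%R)//; last 2 first.
- by apply: emeasurable_funM => //; exact: measurableT_comp mF (measurable_subl _).
- by move=> s; exact: mule_ge0.
apply: eq_integral => s _; congr (F _ * G _); ring.
Qed.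

Lemma eq_conv F F' G G' t : {ae mu, forall s, F s = F' s} ->
  {ae mu, forall s, G s = G' s} -> conv F G t = conv F' G' t.
Proof.
move=> /(ae_subl _ t) FF' GG'; apply: integral_ae.
by apply: ae_impl2 FF' GG' => s /= -> ->.
Qed.

Lemma convDr F G H t :
  measurable_fun setT F -> measurable_fun setT G -> measurable_fun setT H ->
  (forall x, 0 <= F x) -> (forall x, 0 <= G x) -> (forall x, 0 <= H x) ->
  conv F (fun s => G s + H s) t = conv F G t + conv F H t.
Proof.
move=> mF mG mH F0 G0 H0; rewrite /conv -ge0_integralD//.
- by apply: eq_integral => s _; rewrite ge0_muleDr.
- by move=> s _; exact: mule_ge0.
- by apply: emeasurable_funM => //; exact: measurableT_comp mF (measurable_subl _).
- by move=> s _; exact: mule_ge0.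
- by apply: emeasurable_funM => //; exact: measurableT_comp mF (measurable_subl _).
Qed.

Lemma convZr F G (c : R) t :
  measurable_fun setT F -> measurable_fun setT G ->
  (forall x, 0 <= F x) -> (forall x, 0 <= G x) -> (0 <= c)%R ->
  conv F (fun s => c%:E * G s) t = c%:E * conv F G t.
Proof.
move=> mF mG F0 G0 c0; rewrite /conv -ge0_integralZl_EFin//.
- by apply: eq_integral => s _; rewrite muleCA.
- by move=> s _; exact: mule_ge0.
- by apply: emeasurable_funM => //; exact: measurableT_comp mF (measurable_subl _).
Qed.

End Convolution.

(** * Almost everywhere differentiation *)

Section FineIntegral.
Local Open Scope ereal_scope.
Context d (T : measurableType d) (R : realType) (mu : {measure set T -> \bar R}).

Lemma integrable_patch (f : T -> R) (D : set T) : measurable D ->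
  mu.-integrable D (EFin \o f) -> mu.-integrable setT (EFin \o (f \_ D)).
Proof.
by move=> mD fi; rewrite -restrict_EFin; apply/(integrable_mkcond _ mD).1.
Qed.

(** A finite integral makes [Q] finite almost everywhere, so the default value of [fine] at [+oo]
    only matters on a null set. This is the way back from extended to real integrals. *)
Lemma fine_integral (Q : T -> \bar R) (D : set T) : measurable D ->
  measurable_fun D Q -> (forall x, 0 <= Q x) -> \int[mu]_(x in D) Q x < +oo ->
  mu.-integrable D (EFin \o (fine \o Q)) /\
  Rintegral mu D (fine \o Q) = fine (\int[mu]_(x in D) Q x).
Proof.
move=> mD mQ Q0 Qoo.
have iQ : mu.-integrable D Q.
  apply/integrableP; split => //.
  by under eq_integral do rewrite gee0_abs//.
have fQ := integrable_ae mD iQ.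
have QE : {ae mu, forall x, D x -> (fine (Q x))%:E = Q x}.
  by apply: ae_impl fQ => x + Dx => /(_ Dx) /fineK.
have e := integral_ae _ _ _ mu _ _ _ QE; split.
- apply/integrableP; split => /=.
    by apply/measurable_EFinP; exact: measurableT_comp.
  under eq_integral do rewrite ger0_norm ?fine_ge0//.
  by rewrite e.
- by rewrite /Rintegral e.
Qed.

End FineIntegral.

Section Derivative.
Context {R : realType}.
Local Notation mu := (@lebesgue_measure R).

Lemma near_eq_derive1 (F G : R -> R) (t l : R) : {near t, F =1 G} ->
  derivable G t 1 /\ derive1 G t = l -> derivable F t 1 /\ derive1 F t = l.
Proof.
move=> FG [dG <-].
have GF : {near t, G =1 F} by move: FG; apply: filterS => x ->.
split; first exact: near_eq_derivable GF dG.
by rewrite !derive1E; exact: near_eq_derive FG.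
Qed.

Lemma nondecreasing_derive1_ge0 (F : R -> R) (a b t : R) : a < t < b ->
  (forall x y, a < x -> x <= y -> y < b -> F x <= F y) ->
  derivable F t 1 -> 0 <= derive1 F t.
Proof.
move=> /andP[a_t tb] Fnd dF; rewrite derive1E; apply: limr_ge => //.
near=> h.
have /andP[h1 h2] : - (t - a) < h < (b - t).
  have : `|h| < Num.min (t - a) (b - t).
    by near: h; apply: dnbhs0_lt; rewrite lt_min !subr_gt0 a_t.
  by rewrite lt_min !ltr_norml => /andP[/andP[-> _] /andP[_ ->]].
rewrite /= [h *: 1]mulr1.
have [h0|h0] := leP 0 h.
  by apply: mulr_ge0; rewrite ?invr_ge0// subr_ge0; apply: Fnd => //; lra.
rewrite /GRing.scale/= -mulrNN; apply: mulr_ge0.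
  by rewrite oppr_ge0 invr_le0 ltW.
by rewrite oppr_ge0 subr_le0; apply: Fnd => //; lra.
Unshelve. all: by end_near. Qed.

(** Lebesgue differentiation is applied to [f] cut off after [T], which is integrable on the whole
    line; near any [t < T] the two primitives agree. *)
Lemma ae_derive_integral (f : R -> R) (T : R) :
  mu.-integrable `]-oo, T] (EFin \o f) ->
  {ae mu, forall t, t < T ->
    derivable (fun x : R => Rintegral mu `]-oo, x] f) t 1 /\
    derive1 (fun x : R => Rintegral mu `]-oo, x] f) t = f t}.
Proof.
move=> intf; have mA : measurable (`]-oo, T] : set R) by [].
have intfA : mu.-integrable setT (EFin \o (f \_ `]-oo, T])).
  exact: integrable_patch intf.
have locf := integrable_locally mA intf.
have intfy y : mu.-integrable `]-oo, y] (EFin \o (f \_ `]-oo, T])).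
  exact: integrableS intfA.
have := @FTC1Ny R (f \_ `]-oo, T]) intfy locf.
apply: ae_impl => t ft tT.
have <- : (f \_ `]-oo, T]) t = f t.
  by rewrite patchE mem_set//= in_itv/= ltW.
apply: near_eq_derive1 ft.
near=> x; apply: eq_Rintegral => s; rewrite inE/= in_itv/= => sx.
rewrite patchE mem_set//= in_itv/= (le_trans sx)//.
have : x \in `]t - 1, T[.
  near: x; apply: near_in_itvoo.
  by rewrite in_itv/= tT andbT ltrBlDr ltrDl.
by rewrite in_itv/= => /andP[_ /ltW].
Unshelve. all: by end_near. Qed.

Local Open Scope ereal_scope.

(** Differentiation is local, so the formula for [F] is only asked on the open interval. [Q1] and
    [Q2] stand for the positive and negative contributions to a signed density. *)
Lemma ae_derive_integralB (Q1 Q2 : R -> \bar R) (F : R -> R) (T : R) :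
  measurable_fun setT Q1 -> measurable_fun setT Q2 ->
  (forall x, 0 <= Q1 x) -> (forall x, 0 <= Q2 x) ->
  \int[mu]_(x in `]-oo, T]) Q1 x < +oo -> \int[mu]_(x in `]-oo, T]) Q2 x < +oo ->
  (forall t : R, 0 < t < T -> F t =
    fine (\int[mu]_(x in `]-oo, t]) Q1 x) - fine (\int[mu]_(x in `]-oo, t]) Q2 x))%R ->
  {ae mu, forall t : R, (0 < t < T)%R ->
    derivable F t 1 /\ derive1 F t = (fine (Q1 t) - fine (Q2 t))%R}.
Proof.
move=> mQ1 mQ2 Q10 Q20 Q1oo Q2oo FE.
have mA t : measurable (`]-oo, t] : set R) by [].
have mQ1A t : measurable_fun (`]-oo, t] : set R) Q1 by exact: measurable_funTS.
have mQ2A t : measurable_fun (`]-oo, t] : set R) Q2 by exact: measurable_funTS.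
have sub t : (t < T)%R -> `]-oo, t] `<=` (`]-oo, T] : set R).
  by move=> tT x; rewrite /= !in_itv/= => /le_trans; apply; exact: ltW.
have [iq1 _] := fine_integral _ _ _ mu _ _ (mA T) (mQ1A T) Q10 Q1oo.
have [iq2 _] := fine_integral _ _ _ mu _ _ (mA T) (mQ2A T) Q20 Q2oo.
have iq : mu.-integrable `]-oo, T] (EFin \o (fun x => fine (Q1 x) - fine (Q2 x))%R).
  exact: integrableB iq1 iq2.
have := ae_derive_integral _ _ iq.
apply: ae_impl => t ft /andP[t0 tT].
apply: near_eq_derive1 (ft tT).
near=> x.
have /andP[x0 xT] : (0 < x < T)%R.
  have : x \in `]0, T[%R by near: x; apply: near_in_itvoo; rewrite in_itv/= t0.
  by rewrite in_itv/=.
have lt1 (Q : R -> \bar R) : (forall x, 0 <= Q x) -> measurable_fun setT Q ->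
    \int[mu]_(x in `]-oo, T]) Q x < +oo -> \int[mu]_(x in `]-oo, x]) Q x < +oo.
  move=> Q0 mQ; apply: le_lt_trans; apply: ge0_subset_integral => //.
    exact: measurable_funTS.
  exact: sub.
have [_ e1] := fine_integral _ _ _ mu _ _ (mA x) (mQ1A x) Q10 (lt1 _ Q10 mQ1 Q1oo).
have [_ e2] := fine_integral _ _ _ mu _ _ (mA x) (mQ2A x) Q20 (lt1 _ Q20 mQ2 Q2oo).
rewrite FE ?x0//= -e1 -e2 -RintegralB//.
  apply: integrableS iq1 => //; exact: sub.
apply: integrableS iq2 => //; exact: sub.
Unshelve. all: by end_near. Qed.

End Derivative.

(** * Bernstein polynomials *)

Section CoinTossing.
Context {R : realFieldType}.
Implicit Types (x : R) (phi psi : nat -> R).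

(* The expectation of phi (number of heads) after n tosses of a coin with bias
   x: a Bernstein polynomial, but without binomial coefficients. *)
Fixpoint coin (n : nat) phi x : R :=
  if n is m.+1 then x * coin m (phi \o succn) x + (1 - x) * coin m phi x
  else phi 0%N.

Lemma coin_cst n c x : coin n (fun=> c) x = c.
Proof.
elim: n => //= n IH; rewrite (_ : _ \o succn = fun=> c)// IH; ring.
Qed.

Lemma coinB n phi psi x :
  coin n (fun j => phi j - psi j) x = coin n phi x - coin n psi x.
Proof.
elim: n phi psi => //= n IH phi psi.
rewrite (_ : _ \o succn = fun j => (phi \o succn) j - (psi \o succn) j)// !IH.
ring.
Qed.

Lemma coinZ n phi c x : coin n (fun j => c * phi j) x = c * coin n phi x.
Proof.
elim: n phi => //= n IH phi.
rewrite (_ : _ \o succn = fun j => c * (phi \o succn) j)// !IH; ring.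
Qed.

Lemma ler_coin n phi psi x : 0 <= x <= 1 -> (forall j, phi j <= psi j) ->
  coin n phi x <= coin n psi x.
Proof.
move=> /andP[x0 x1]; elim: n phi psi => //= n IH phi psi le.
apply: lerD; apply: ler_wpM2l; rewrite ?subr_ge0//; apply: IH => // j.
exact: le.
Qed.

Lemma ler_norm_coin n phi psi x : 0 <= x <= 1 ->
  (forall j, `|phi j| <= psi j) -> `|coin n phi x| <= coin n psi x.
Proof.
move=> x01 le; rewrite ler_norml; apply/andP; split.
  rewrite -mulN1r -coinZ; apply: ler_coin => // j.
  by rewrite mulN1r; have := le j; rewrite ler_norml => /andP[].
by apply: ler_coin => // j; rewrite (le_trans _ (le j))// ler_norm.
Qed.

(** The second moment about [c] is the binomial variance plus the squared bias. An arbitrary [c] is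
    needed for the induction: a first head shifts it to [c - 1]. *)
Lemma coin_variance n c x : coin n (fun j => (j%:R - c) ^+ 2) x =
  n%:R * (x * (1 - x)) + (n%:R * x - c) ^+ 2.
Proof.
elim: n c => [|n IH] c /=; first by ring.
rewrite (_ : _ \o succn = fun j => (j%:R - (c - 1)) ^+ 2); last first.
  by apply/funext => j /=; rewrite -natr1; ring.
by rewrite !IH -natr1; ring.
Qed.

Definition window (c d : R) (n j : nat) : R := (c < j%:R / n%:R < d)%R%:R.

(** Chebyshev's inequality. If the frequency [y] of heads is within [e] of [x], it lies on the same
    side of [c] and [d] as [x]; otherwise the error is at most [((y - x) / e) ^+ 2], whose
    expectation [coin_variance] computes. *)
Lemma coin_window_le (c d x e : R) n : 0 <= x <= 1 -> 0 < e ->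
  e <= `|x - c| -> e <= `|x - d| ->
  `|coin n.+1 (window c d n.+1) x - (c < x < d)%R%:R| <= (n.+1%:R * e ^+ 2)^-1.
Proof.
move=> x01 e0 xc xd; have n0 : 0 < n.+1%:R :> R by [].
rewrite -[X in _ - X](coin_cst n.+1 _ x) -coinB.
apply: le_trans (ler_norm_coin n.+1 _
  (fun j => (n.+1%:R * e) ^- 2 * (j%:R - n.+1%:R * x) ^+ 2) x x01 _) _; last first.
  rewrite coinZ coin_variance subrr expr0n/= addr0.
  rewrite (_ : _ * _ = x * (1 - x) * (n.+1%:R * e ^+ 2)^-1); last first.
    by field; rewrite !gt_eqF.
  rewrite ler_piMl ?invr_ge0 ?mulr_ge0 ?sqr_ge0 ?(ltW e0)//.
  by move: x01 => /andP[? ?]; nra.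
move=> j; rewrite /window; set y := j%:R / n.+1%:R.
have -> : (n.+1%:R * e) ^- 2 * (j%:R - n.+1%:R * x) ^+ 2 = ((y - x) / e) ^+ 2.
  by rewrite /y; field; rewrite !gt_eqF.
have [yxe|yxe] := ltP `|y - x| e.
  suff -> : (c < y < d) = (c < x < d) by rewrite subrr normr0 sqr_ge0.
  have side a : e <= `|x - a| -> (a < y) = (a < x) /\ (y < a) = (x < a).
    by move: yxe; rewrite ltr_norml => /andP[? ?]; rewrite ler_normr;
      move=> /orP[] ?; split; apply/idP/idP => ?; lra.
  by rewrite (side _ xc).1 (side _ xd).2.
apply: (@le_trans _ _ 1).
  by case: (_ < _ < _)%R; case: (_ < _ < _)%R;
    rewrite ?subrr ?normr0 ?subr0 ?sub0r ?normrN ?normr1.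
rewrite -real_normK ?num_real// normrM normfV (gtr0_norm e0).
by apply: exprn_ege1; rewrite ler_pdivlMr ?mul1r.
Qed.

End CoinTossing.

(** * Completely monotone sequences *)

Section AlternatingDifferences.
Context {R : realFieldType}.
Implicit Types (f g b : nat -> R).

(** The backward sign makes all iterates nonnegative on a completely monotone sequence, with no
    alternating factor. *)
Definition Delta (f : nat -> R) (n : nat) : R := f n - f n.+1.

(** Complete monotonicity truncated at order [n], so that reciprocals can be handled by induction on
    the order. *)
Fixpoint cm_upto (n : nat) f : Prop :=
  (forall i, 0 <= f i) /\ (if n is m.+1 then cm_upto m (Delta f) else True).

Lemma cm_upto_ge0 n f : cm_upto n f -> forall i, 0 <= f i.
Proof. by case: n => [|n] []. Qed.

Lemma cm_uptoW n f : cm_upto n.+1 f -> cm_upto n f.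
Proof.
by elim: n f => [|n IH] f [f0 cf]; split => //; exact: IH.
Qed.

Lemma cm_uptoD n f g : cm_upto n f -> cm_upto n g ->
  cm_upto n (fun i => f i + g i).
Proof.
elim: n f g => [|n IH] f g [f0 cf] [g0 cg]; split => //.
- by move=> i; exact: addr_ge0.
- by move=> i; exact: addr_ge0.
rewrite (_ : Delta _ = fun i => Delta f i + Delta g i); first exact: IH.
by apply/funext => i; rewrite /Delta; ring.
Qed.

Lemma cm_upto_shift n f : cm_upto n f -> cm_upto n (f \o succn).
Proof.
elim: n f => [|n IH] f [f0 cf]; split => //.
- by move=> i; exact: f0.
- by move=> i; exact: f0.
exact: (IH _ cf).
Qed.

(** Discrete Leibniz rule: [Delta] of a product is [f i * Delta g i + Delta f i * g i.+1]. *)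
Lemma cm_uptoM n f g : cm_upto n f -> cm_upto n g ->
  cm_upto n (fun i => f i * g i).
Proof.
elim: n f g => [|n IH] f g cf cg; split => //.
- by move=> i; apply: mulr_ge0; [exact: cm_upto_ge0 cf _|exact: cm_upto_ge0 cg _].
- by move=> i; apply: mulr_ge0; [exact: cm_upto_ge0 cf _|exact: cm_upto_ge0 cg _].
rewrite (_ : Delta _ = fun i => f i * Delta g i + Delta f i * (g \o succn) i).
  apply: cm_uptoD; apply: IH.
  - exact: cm_uptoW.
  - exact: cg.2.
  - exact: cf.2.
  - exact/cm_upto_shift/cm_uptoW.
by apply/funext => i; rewrite /Delta /=; ring.
Qed.

(* The reciprocal g of a Bernstein function B with increments b satisfies
   [Delta g i = g i * g i.+1 * b i], which has the sign pattern of a product. *)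
Lemma cm_uptoV n (B : nat -> R) : (forall i, 0 < B i) ->
  cm_upto n (fun i => B i.+1 - B i) -> cm_upto n (fun i => (B i)^-1).
Proof.
move=> B0; elim: n => [|n IH] cb.
  by split => // i; rewrite invr_ge0 ltW.
split; first by move=> i; rewrite invr_ge0 ltW.
(* The claim for the reciprocal at order [n] suffices here, since taking [Delta] lowers the required
   order by one. *)
have cg := IH (cm_uptoW _ _ cb).
rewrite (_ : Delta _ = fun i => (B i)^-1 * ((fun i => (B i)^-1) \o succn) i *
    (B i.+1 - B i)); last first.
  by apply/funext => i; rewrite /Delta /=; field; rewrite !gt_eqF.
apply: cm_uptoM; last exact: cm_uptoW.
by apply: cm_uptoM => //; exact: cm_upto_shift.
Qed.

Lemma cm_upto_cst n (c : R) : 0 <= c -> cm_upto n (fun=> c).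
Proof.
elim: n c => [|n IH] c c0; split => //.
rewrite (_ : Delta _ = fun=> 0); first exact: IH.
by apply/funext => i; rewrite /Delta subrr.
Qed.

Lemma cm_upto_iter n f : (forall m, (m <= n)%N -> forall i, 0 <= iter m Delta f i) <->
  cm_upto n f.
Proof.
elim: n f => [|n IH] f; split.
- by move=> f0; split => //; exact: (f0 0%N).
- by move=> [f0 _] m; rewrite leqn0 => /eqP ->.
- move=> f0; split; first exact: (f0 0%N).
  by apply/IH => m mn i; rewrite -iterSr; apply: f0.
- move=> [f0 /IH cf] [|m] //= mn i.
  by have := cf m mn i; rewrite -iterSr.
Qed.

(** The denominators have constant increments [1], so [cm_uptoV] applies. *)
Lemma cm_upto_inv_shift n (t : R) : 0 <= t ->
  cm_upto n (fun i : nat => (i.+1%:R + t)^-1).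
Proof.
move=> t0; apply: cm_uptoV => [i|].
  by rewrite ltr_pwDl.
rewrite (_ : (fun _ => _) = fun=> 1); first exact: cm_upto_cst.
by apply/funext => i; rewrite -[i.+2%:R]natr1; ring.
Qed.

(* [p / (p + t)] has increments [t / ((p + t) (p + 1 + t))] *)
Lemma cm_upto_incr n (t : R) : 0 <= t -> cm_upto n (fun i : nat =>
  i.+2%:R / (i.+2%:R + t) - i.+1%:R / (i.+1%:R + t)).
Proof.
move=> t0; rewrite (_ : (fun _ => _) = fun i : nat =>
  t * ((i.+1%:R + t)^-1 * ((fun i : nat => (i.+1%:R + t)^-1) \o succn) i)).
  apply: cm_uptoM; first exact: cm_upto_cst.
  apply: cm_uptoM; first exact: cm_upto_inv_shift.
  by apply: (cm_upto_shift _ (fun i : nat => (i.+1%:R + t)^-1));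
    exact: cm_upto_inv_shift.
apply/funext => i /=; rewrite -[i.+2%:R]natr1; field.
by rewrite -addrA !gt_eqF// ?ltr_pwDl// ?addr_ge0.
Qed.

End AlternatingDifferences.

(** * Functions with a completely monotone Laplace transform *)

Section LaplaceSign.
Context {R : realType}.
Local Notation mu := (@lebesgue_measure R).

Lemma ae_neq (z : R) : {ae mu, forall t : R, t <> z}.
Proof.
exists [set z]; split => //; first exact: lebesgue_measure_set1.
by move=> t /= /contrapT.
Qed.

Lemma ae_lt_natr (P : R -> Prop) :
  (forall n : nat, {ae mu, forall t : R, t < n%:R -> P t}) ->
  {ae mu, forall t, P t}.
Proof.
move=> H; have := ae_foralln H.
apply: ae_impl => t Pt; apply: (Pt (Num.bound `|t|)).
exact: (le_lt_trans (ler_norm t) (archi_boundP (normr_ge0 t))).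
Qed.

Section Sign.
Variable h : R -> R.
Hypothesis lh : forall p : R, 0 < p -> laplace_exists h p.

(** With [x = expR (- t)] this is the Hausdorff moment integrand [x ^+ m * (1 - x) ^+ l] against the
    weight [expR (- t) * h t], which is integrable by the Laplace condition at [p = 1]. *)
Definition mterm (m l : nat) (t : R) : R :=
  expR (- t) ^+ m * (1 - expR (- t)) ^+ l * (expR (- t) * h t).

Lemma expRN01 (t : R) : 0 < t -> 0 <= expR (- t) <= 1.
Proof. by move=> t0; rewrite expR_ge0/= ltW// expR_lt1 oppr_lt0. Qed.

Lemma integrable_mterm m l : mu.-integrable `]0, +oo[ (EFin \o mterm m l).
Proof.
have i1 : mu.-integrable `]0, +oo[ (EFin \o (fun t => expR (- t) * h t)).
  have := lh 1 ltr01; rewrite /laplace_exists.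
  by apply: eq_integrable => // t _; rewrite mul1r.
have mi1 : measurable_fun (`]0, +oo[ : set R) (fun t : R => expR (- t) * h t).
  by apply/measurable_EFinP; exact: measurable_int i1.
have me : measurable_fun (`]0, +oo[ : set R) (fun t : R => expR (- t)).
  by apply: measurable_funTS; apply: measurableT_comp.
apply: le_integrable i1 => //.
  apply/measurable_EFinP; apply: measurable_funM => //.
  apply: measurable_funM; first exact: measurable_funX.
  by apply: measurable_funX; apply: measurable_funB.
move=> t /=; rewrite in_itv/= andbT => t0.
have /andP[e0 e1] := expRN01 _ t0.
rewrite lee_fin /mterm normrM ler_piMl// normrM !normrX mulr_ile1//.
  by rewrite exprn_ile1// ger0_norm.
by rewrite exprn_ile1// ger0_norm// ?subr_ge0// gerBl.
Qed.

(** Each factor [1 - expR (- t)] acts as one [Delta], because [mterm m l.+1] is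
    [mterm m l - mterm m.+1 l]. *)
Lemma integral_mterm m l : Rintegral mu `]0, +oo[ (mterm m l) =
  iter l Delta (fun m => laplace h m.+1%:R) m.
Proof.
elim: l m => [|l IH] m.
  apply: eq_Rintegral => t _; rewrite /mterm expr0 mulr1 mulrA; congr (_ * _).
  by rewrite -exprSr -expRM_natl mulrN.
rewrite iterS /Delta -!IH -RintegralB//; [|exact: integrable_mterm..].
by apply: eq_Rintegral => t _; rewrite /mterm exprS exprS; ring.
Qed.

Hypothesis h_cm : forall l m, 0 <= iter l Delta (fun m => laplace h m.+1%:R) m.

(** Every toss contributes a factor [expR (- t)] or [1 - expR (- t)], absorbed by raising [m] or
    [l]. The integral is thus a nonnegative combination of moment differences, which [h_cm]
    controls. *)
Lemma integral_coin_ge0 n phi m l : (forall j, 0 <= phi j) ->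
  mu.-integrable `]0, +oo[ (EFin \o (fun t => coin n phi (expR (- t)) * mterm m l t))
  /\ (0 <= \int[mu]_(t in `]0%R, +oo[) (coin n phi (expR (- t)) * mterm m l t)%:E)%E.
Proof.
elim: n phi m l => [|n IH] phi m l phi0 /=.
  have i1 := integrable_mterm m l.
  split.
    have := integrableZl _ (phi 0%N) i1.
    by move=> /(_ (measurable_itv _)); apply: eq_integrable.
  under eq_integral do rewrite EFinM.
  rewrite integralZl//; apply: mule_ge0; first by rewrite lee_fin.
  rewrite -[X in (_ <= X)%E]fineK ?integrable_fin_num// lee_fin.
  by have := h_cm l m; rewrite -integral_mterm.
have E t : (expR (- t) * coin n (phi \o succn) (expR (- t)) +
     (1 - expR (- t)) * coin n phi (expR (- t))) * mterm m l t =
   coin n (phi \o succn) (expR (- t)) * mterm m.+1 l t +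
   coin n phi (expR (- t)) * mterm m l.+1 t.
  by rewrite /mterm !exprS; ring.
have [i1 p1] := IH (phi \o succn) m.+1 l (fun j => phi0 j.+1).
have [i2 p2] := IH phi m l.+1 phi0.
split.
  have := integrableD _ i1 i2.
  by move=> /(_ (measurable_itv _)); apply: eq_integrable => // t _ /=; rewrite E EFinD.
under eq_integral do rewrite E EFinD.
rewrite integralD//; exact: adde_ge0.
Qed.

(* The Bernstein polynomials of the indicator of [(exp (- z), exp (- y))] tend to
   that indicator off its endpoints. *)
Lemma integral_window_ge0 (y z : R) : 0 < y -> y < z ->
  (0 <= \int[mu]_(t in `]0%R, +oo[) ((y < t < z)%R%:R * mterm 0 0 t)%:E)%E.
Proof.
move=> y0 yz; set c := expR (- z); set d := expR (- y).
pose f_ n (t : R) := (coin n.+1 (window c d n.+1) (expR (- t)) * mterm 0 0 t)%:E.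
have w01 n j : 0 <= window c d n j <= 1.
  by rewrite /window; case: (_ < _ < _)%R; rewrite ?lexx ?ler01.
have fge0 n : (0 <= \int[mu]_(t in `]0%R, +oo[) f_ n t)%E.
  by apply: (integral_coin_ge0 _ _ _ _ _).2 => j; have /andP[] := w01 n.+1 j.
have mf n : measurable_fun (`]0, +oo[ : set R) (f_ n).
  have [i _] := integral_coin_ge0 n.+1 (window c d n.+1) 0 0
    (fun j => proj1 (andP (w01 n.+1 j))).
  exact: measurable_int i.
have i0 := integrable_mterm 0 0.
have wE t : (y < t < z)%R = (c < expR (- t) < d)%R.
  by rewrite !ltr_expR !ltrN2 andbC.
have mw : measurable_fun (`]0, +oo[ : set R)
    (fun t : R => ((y < t < z)%R%:R * mterm 0 0 t)%:E).
  apply/measurable_EFinP; apply: measurable_funM; last first.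
    by apply/measurable_EFinP; exact: measurable_int i0.
  apply: measurable_funTS.
  rewrite (_ : (fun _ => _) = \1_(`]y, z[ : set R))//.
  by apply/funext => t; rewrite indicE mem_setE in_itv.
have cv : {ae mu, forall t : R, `]0, +oo[%classic t -> f_ ^~ t @ \oo -->
    ((y < t < z)%R%:R * mterm 0 0 t)%:E}.
  apply: ae_impl2 (ae_neq y) (ae_neq z) => t ty tz; rewrite /= in_itv/= andbT => t0.
  apply: cvg_EFin; first by apply: nearW.
  apply: cvgM; last exact: cvg_cst.
  rewrite wE; apply/cvgrPdist_le => /= e e0.
  (* The distance to the nearer endpoint is positive off the two excluded points, so the Chebyshev
     bound tends to zero. *)
  pose r := Num.min `|expR (- t) - c| `|expR (- t) - d|.
  have r0 : 0 < r.
    rewrite lt_min !normr_gt0 !subr_eq0 /c /d.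
    by apply/andP; split; apply/eqP => /expR_inj /oppr_inj.
  have : (n.+1%:R * r ^+ 2)^-1 @[n --> \oo] --> (0 : R).
    rewrite (_ : (fun _ => _) = (fun n => (r ^+ 2)^-1 * (n.+1%:R)^-1)); last first.
      by apply/funext => n; rewrite invfM mulrC.
    rewrite -(mulr0 (r ^+ 2)^-1); apply: cvgM; [exact: cvg_cst|exact: cvg_harmonic].
  move=> /cvgrPdist_le /(_ _ e0); apply: filterS => n /=.
  rewrite sub0r normrN => le; rewrite distrC.
  apply: (le_trans (coin_window_le c d (expR (- t)) r n (expRN01 _ t0) r0 _ _)).
  - by rewrite ge_min lexx.
  - by rewrite ge_min lexx orbT.
  - by rewrite (le_trans (ler_norm _)).
have dom : {ae mu, forall (t : R) n, `]0, +oo[%classic t ->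
    (`|f_ n t| <= `|(mterm 0 0 t)%:E|)%E}.
  apply: aeW => t n; rewrite /= in_itv/= andbT => t0.
  rewrite lee_fin normrM ler_piMl//.
  rewrite -[leRHS](coin_cst n.+1 1 (expR (- t))).
  apply: (ler_norm_coin n.+1 (window c d n.+1)); first exact: expRN01.
  by move=> j; have /andP[? ?] := w01 n.+1 j; rewrite ger0_norm.
have [_ _ cvI] := @dominated_convergence _ _ _ mu _ (measurable_itv _) f_ _ _
  mf mw cv (integrable_abse i0) dom.
by apply: (cvge_to_ge cvI); apply: nearW => n; exact: fge0.
Qed.

(** Nonnegative interval integrals make the primitive [G] of [expR (- t) * h t] nondecreasing on the
    positive axis, and its derivative is that function almost everywhere. *)
Lemma laplace_cm_ge0 : {ae mu, forall t : R, 0 < t -> 0 <= h t}.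
Proof.
pose f := mterm 0 0 \_ `]0, +oo[.
have fi : mu.-integrable setT (EFin \o f).
  by apply: integrable_patch => //; exact: integrable_mterm.
pose G (x : R) := Rintegral mu `]-oo, x] f.
have Gnd (y z : R) : 0 < y -> y <= z -> G y <= G z.
  rewrite le_eqVlt => y0 /predU1P[->//|yz].
  rewrite -subr_ge0 /G.
  rewrite (@Rintegral_itvB _ f -oo%O (BRight z) y)//; last 2 first.
  - exact: integrableS fi.
  - by rewrite bnd_simp ltW.
  rewrite /Rintegral fine_ge0// (le_trans (integral_window_ge0 _ _ y0 yz))//.
  rewrite [leLHS]integral_mkcond [leRHS]integral_mkcond le_eqVlt; apply/orP; left; apply/eqP.
  apply: integral_ae; apply: ae_impl (ae_neq z) => t tz _.
  rewrite !patchE !mem_setE !in_itv/= /f patchE mem_setE in_itv/= !andbT.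
  have [t0|t0] := ltP 0 t.
    rewrite [t <= z]le_eqVlt (introF eqP tz)/=.
    by case: (_ < _ < _)%R; rewrite ?mul1r ?mul0r.
  by rewrite ltNge (le_trans t0 (ltW y0)).
have : {ae mu, forall t, derivable G t 1 /\ derive1 G t = f t}.
  apply: ae_lt_natr => n; apply: ae_derive_integral.
  exact: integrableS fi.
apply: ae_impl => t [dG Gf] t0.
have : 0 <= f t.
  rewrite -Gf; apply: (nondecreasing_derive1_ge0 G 0 (t + 1)) => //.
    by apply/andP; split; [exact: t0|rewrite ltrDl].
  by move=> x y x0 xy _; exact: Gnd.
rewrite /f patchE mem_setE in_itv/= t0/= /mterm !expr0 !mul1r.
by rewrite pmulr_rge0// expR_gt0.
Qed.

End Sign.

(** Uniqueness of the Laplace transform from the sign result: a zero transform is completely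
    monotone, so both [h] and [- h] are nonnegative almost everywhere. *)
Lemma laplace0_ae0 (h : R -> R) : (forall p : R, 0 < p -> laplace_exists h p) ->
  (forall p : R, 0 < p -> laplace h p = 0) -> {ae mu, forall t : R, 0 < t -> h t = 0}.
Proof.
move=> lh h0.
have cm0 (g : R -> R) : (forall p : R, 0 < p -> laplace g p = 0) ->
    forall l m, iter l Delta (fun m => laplace g m.+1%:R) m = 0.
  by move=> g0; elim => [|l IH] m /=; [exact: g0|rewrite /Delta !IH subr0].
have lhN p : 0 < p -> laplace_exists (\- h) p.
  move=> p0; have := integrableN (lh _ p0); rewrite /laplace_exists.
  by apply: eq_integrable => // t _ /=; rewrite mulrN.
have hN0 p : 0 < p -> laplace (\- h) p = 0.
  move=> p0; rewrite -oppr0 -(h0 _ p0) /laplace -[RHS]mulN1r -RintegralZl//.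
    by apply: eq_Rintegral => t _ /=; rewrite mulN1r mulrN.
  exact: lh.
apply: ae_impl2 (laplace_cm_ge0 _ lh _) (laplace_cm_ge0 _ lhN _) => [t h1 h2 t0||].
- by apply/eqP; rewrite eq_le h1// andbT -oppr_ge0 h2.
- by move=> l m; rewrite cm0.
- by move=> l m; rewrite cm0.
Qed.

End LaplaceSign.

(** * Absolutely continuous functions *)

Section Chains.
Context {R : realType}.
Implicit Types (a b : R) (s : seq (R * R)).

(** Lists of ordered nonoverlapping intervals replace the indexed families of [abs_cont_on], so that
    families can be concatenated and refined by induction. *)
Fixpoint chain a s b : Prop :=
  if s is p :: s' then [/\ a <= p.1, p.1 <= p.2 & chain p.2 s' b] else a <= b.

Definition incr (F : R -> R) s : R := \sum_(p <- s) (F p.2 - F p.1).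

Lemma chain_le a s b : chain a s b -> a <= b.
Proof.
elim: s a => //= p s IH a [ap pp /IH pb].
exact: le_trans ap (le_trans pp pb).
Qed.

Lemma chain_lel a a' s b : a' <= a -> chain a s b -> chain a' s b.
Proof.
by case: s => [|p s] /= aa; [exact: le_trans|case=> ap ? ?; split => //; exact: le_trans ap].
Qed.

Lemma chain_cat a s1 s2 b :
  chain a (s1 ++ s2) b <-> exists c, chain a s1 c /\ chain c s2 b.
Proof.
elim: s1 a => [|p s IH] a /=; split.
- by move=> h; exists a.
- by move=> [c [ac]]; exact: chain_lel.
- by move=> [h1 h2 /IH[c [? ?]]]; exists c.
- by move=> [c [[h1 h2 h3] h4]]; split => //; apply/IH; exists c.
Qed.

Lemma chain_nth a s b x0 : chain a s b -> forall i, (i < size s)%N ->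
  [/\ a <= (nth x0 s i).1, (nth x0 s i).1 <= (nth x0 s i).2 & (nth x0 s i).2 <= b].
Proof.
elim: s a => //= p s IH a [ap pp ps] [|i] /=.
  by move=> _; split => //; exact: chain_le ps.
rewrite ltnS => /(IH _ ps)[h1 h2 h3]; split => //.
exact: le_trans ap (le_trans pp h1).
Qed.

Lemma chain_nth_lt a s b x0 : chain a s b -> forall i j, (i < j < size s)%N ->
  (nth x0 s i).2 <= (nth x0 s j).1.
Proof.
elim: s a => [|p s IH] a /=; first by move=> _ i j /andP[].
move=> [ap pp ps] [|i] [|j] //=.
  by rewrite ltnS => js; have [] := chain_nth _ _ _ x0 ps j js.
by rewrite !ltnS; exact: (IH _ ps).
Qed.

Fixpoint steps a (l : seq R) : seq (R * R) :=
  if l is y :: l' then (a, y) :: steps y l' else [::].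

Lemma chain_steps a l b : itv_partition a b l -> chain a (steps a l) b.
Proof.
move=> [pl /eqP <-]; elim: l a pl => //= y l IH a /andP[/ltW ay pl].
by split => //; exact: IH.
Qed.

Lemma incr_steps F a l b : itv_partition a b l -> incr F (steps a l) = F b - F a.
Proof.
move=> [pl /eqP <-]; elim: l a pl => [|y l IH] a /=.
  by rewrite /incr big_nil subrr.
by move=> /andP[_ pl]; rewrite /incr big_cons -/(incr F _) IH//=; ring.
Qed.

Lemma variation_steps (u : R -> R) a l b : itv_partition a b l ->
  variation a b u l = \sum_(p <- steps a l) `|u p.2 - u p.1|.
Proof.
move=> h; rewrite variation_zip//; elim: l a h => [|y l IH] a h /=.
  by rewrite !big_nil.
by rewrite !big_cons /= -IH//; exact: itv_partition_cons h.
Qed.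

(** Absolute values are left out because this is meant for nondecreasing [F], whose increments over
    a chain are nonnegative. *)
Definition chain_ac (T : R) (F : R -> R) := forall eps : R, 0 < eps ->
  exists2 delta : R, 0 < delta & forall s, chain 0 s T -> incr id s < delta ->
    incr F s <= eps.

(** * Total variation and Jordan decomposition *)

Section TotalVariation.
Variables (u : R -> R) (T : R).
Hypothesis T0 : 0 < T.
Hypothesis u_ac : abs_cont_on u 0 T.
Local Notation TV := (@total_variation R).

Lemma abs_cont_chain eps : 0 < eps -> exists2 delta : R, 0 < delta &
  forall s, chain 0 s T -> incr id s < delta -> \sum_(p <- s) `|u p.2 - u p.1| < eps.
Proof.
move=> e0; have [delta d0 H] := u_ac eps e0; exists delta => // s cs ls.
have := H (size s) (fun i => (nth (0, 0) s i).1) (fun i => (nth (0, 0) s i).2).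
rewrite [in X in _ -> X](big_nth (0, 0)) big_mkord; apply.
- by move=> i si; have [? ? ?] := chain_nth _ _ _ (0, 0) cs i si; split.
- exact: chain_nth_lt cs.
- by move: ls; rewrite /incr (big_nth (0, 0)) big_mkord.
Qed.

Lemma tv_sum_ge0 a s b : chain a s b -> (0 <= \sum_(p <- s) TV p.1 p.2 u)%E.
Proof.
elim: s a => [|p s IH] a /=; first by rewrite big_nil.
move=> [_ pp /IH s0]; rewrite big_cons adde_ge0//.
exact: total_variation_ge0.
Qed.

(** Partitioning the intervals of a chain keeps its total length, so the [delta] for [u] also serves
    for its variation. Passing to suprema makes the bound non-strict. *)
Lemma tv_chain eps : 0 < eps -> exists2 delta : R, 0 < delta &
  forall s, chain 0 s T -> incr id s < delta ->
    (\sum_(p <- s) TV p.1 p.2 u <= eps%:E)%E.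
Proof.
move=> e0; have [delta d0 H] := abs_cont_chain _ e0; exists delta => //.
(* Replace the intervals of a chain by partitions, starting from the right. *)
suff key s s' : chain 0 (s ++ s') T -> incr id (s ++ s') < delta ->
    (\sum_(p <- s) TV p.1 p.2 u + (\sum_(p <- s') `|u p.2 - u p.1|)%:E <= eps%:E)%E.
  move=> s cs ls; have := key s [::]; rewrite cats0 big_nil adde0.
  exact.
elim/last_ind: s s' => [|s [x y] IH] s' cs ls.
  by rewrite big_nil add0e lee_fin ltW//; exact: H.
rewrite -cats1 big_cat big_seq1 /=.
move: (cs); rewrite cat_rcons => /chain_cat[c [cs1 [/= cx xy ys']]].
set B := (\sum_(p <- s') `|u p.2 - u p.1|).
have Bge0 : 0 <= B by apply: sumr_ge0.
have step l : itv_partition x y l ->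
    (\sum_(p <- s) TV p.1 p.2 u + B%:E + (variation x y u l)%:E <= eps%:E)%E.
  move=> xyl.
  have h1 : chain 0 (s ++ steps x l ++ s') T.
    apply/chain_cat; exists c; split => //; apply/chain_cat; exists y; split => //.
    by apply: chain_lel cx _; exact: chain_steps.
  have h2 : incr id (s ++ steps x l ++ s') < delta.
    move: ls; rewrite cat_rcons /incr !big_cat big_cons /= -!/(incr _ _).
    by have := incr_steps id x l y xyl; rewrite /incr => ->.
  have := IH _ h1 h2; rewrite big_cat /= -(variation_steps _ _ _ y)// EFinD.
  by rewrite -addeA [X in (_ + X <= _)%E -> _]addeC.
rewrite -addeA [X in (_ + X)%E]addeC addeA.
set A := (X in (X + _)%E).
have A0 : (0 <= A)%E.
  apply: adde_ge0; rewrite ?lee_fin//.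
  exact: tv_sum_ge0 cs1.
(* One partition is enough to see that [A] is finite; [A] can then be moved across the inequality
   before taking the supremum. *)
have [v [l xyl _]] : exists v, exists2 l, itv_partition x y l & variation x y u l = v.
  move: xy; rewrite le_eqVlt => /predU1P[<-|xy].
    by exists 0, [::]; [split|rewrite variation_nil].
  by exists (variation x y u [:: y]), [:: y] => //; exact: itv_partition1.
have Afin : A \is a fin_num.
  rewrite ge0_fin_numE//; apply: le_lt_trans (ltry eps).
  by apply: le_trans (step l xyl); rewrite leeDl// lee_fin variation_ge0.
rewrite -leeBrDl//; apply: ge_ereal_sup => _ [_ [l' xyl' <-] <-].
by rewrite leeBrDl//; exact: step.
Qed.

(** Cut the interval into pieces of length [h < delta]: each has variation at most [1], so the
    variation up to [i%:R * h] is at most [i]. *)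
Lemma tv_fin : TV 0 T u \is a fin_num.
Proof.
have [delta d0 H] := tv_chain _ ltr01.
have [N NT] : exists N : nat, T < N.+1%:R * delta.
  exists (Num.bound (T / delta)).
  have := archi_boundP (divr_ge0 (ltW T0) (ltW d0)).
  rewrite ltr_pdivrMr// => /lt_le_trans; apply.
  by rewrite ler_pM2r// ler_nat.
pose h := T / N.+1%:R.
have h0 : 0 < h by rewrite divr_gt0.
have hd : h < delta by rewrite ltr_pdivrMr// mulrC.
have hT : N.+1%:R * h = T by rewrite /h mulrC divfK.
suff : forall i, (i <= N.+1)%N -> (TV 0 (i%:R * h) u <= i%:R%:E)%E.
  move=> /(_ N.+1 (leqnn _)); rewrite hT => le.
  rewrite ge0_fin_numE ?total_variation_ge0 ?(ltW T0)//.
  exact: le_lt_trans le (ltry _).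
elim=> [|i IH] iN; first by rewrite mul0r total_variationxx.
have ih : 0 <= i%:R * h by rewrite mulr_ge0// ltW.
have ih' : i%:R * h <= i.+1%:R * h by rewrite ler_pM2r// ler_nat.
rewrite (@total_variationD R 0 (i.+1%:R * h) (i%:R * h))// -natr1 EFinD leeD//.
  exact/IH/ltnW.
have := H [:: (i%:R * h, i.+1%:R * h)]; rewrite /incr !big_seq1 /= natr1; apply.
  by split => //; rewrite -hT ler_pM2r// ler_nat.
by rewrite -natr1 mulrDl mul1r addrAC subrr add0r.
Qed.

Let v x := fine (TV 0 x u).

Lemma tvB x y : 0 <= x -> x <= y -> y <= T -> (v y - v x)%:E = TV x y u.
Proof.
move=> x0 xy yT.
have fin a b : 0 <= a -> a <= b -> b <= T -> TV a b u \is a fin_num.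
  move=> a0 ab bT; have bv := (bounded_variationP u (ltW T0)).2 tv_fin.
  apply/(bounded_variationP u ab); apply: (bounded_variationl ab bT).
  exact: (bounded_variationr a0 (le_trans ab bT)).
have y0 := le_trans x0 xy; have xT := le_trans xy yT.
rewrite EFinB !fineK ?fin// (@total_variationD R 0 y x)// addeAC subee ?fin//.
by rewrite add0e.
Qed.

(** Jordan decomposition with [F] the variation function [v] and [G = v - u]. Since [v] dominates
    the increments of [u], those of [G] are at most twice those of [v]. *)
Lemma abs_cont_monotone_diff : exists F G : R -> R,
  [/\ {in `[0, T] &, nondecreasing_fun F}, {in `[0, T] &, nondecreasing_fun G},
      chain_ac T F, chain_ac T G & forall x, 0 <= x <= T -> u x = F x - G x].
Proof.
have vB x y : 0 <= x -> x <= y -> y <= T -> `|u y - u x| <= v y - v x.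
  by move=> x0 xy yT; rewrite -lee_fin tvB// total_variation_ge.
have incrTV s a : 0 <= a -> chain a s T -> (incr v s)%:E = (\sum_(p <- s) TV p.1 p.2 u)%E.
  elim: s a => [|p s IH] a a0 /=; first by rewrite /incr !big_nil.
  move=> [ap pp ps]; have p0 := le_trans a0 ap.
  rewrite /incr !big_cons EFinD -/(incr v s) (IH p.2) ?(le_trans p0)//.
  by rewrite tvB//; exact: chain_le ps.
have vac : chain_ac T v.
  move=> e e0; have [d d0 H] := tv_chain _ e0; exists d => // s cs ls.
  by rewrite -lee_fin (incrTV s 0)//; exact: H.
exists v, (fun x => v x - u x); split => //.
- move=> x y; rewrite !in_itv/= => /andP[x0 xT] /andP[y0 yT] xy.
  by rewrite -subr_ge0; apply: le_trans (vB x y x0 xy yT).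
- move=> x y; rewrite !in_itv/= => /andP[x0 xT] /andP[y0 yT] xy.
  have := vB x y x0 xy yT; rewrite ler_norml => /andP[_]; lra.
- move=> e e0; have [d d0 H] := vac (e / 2) (divr_gt0 e0 (ltr0Sn R 1)).
  exists d => // s cs ls; apply: (le_trans _ (_ : 2 * incr v s <= _)); last first.
    by have := H s cs ls; lra.
  suff key a : 0 <= a -> chain a s T -> incr (fun x => v x - u x) s <= 2 * incr v s.
    exact: key cs.
  elim: s {cs ls} a => [|p s IH] a a0 /=; first by rewrite /incr !big_nil mulr0.
  move=> [ap pp ps]; rewrite /incr !big_cons mulrDr; apply: lerD; last first.
    by apply: (IH p.2) => //; exact: le_trans a0 (le_trans ap pp).
  have := vB p.1 p.2 (le_trans a0 ap) pp (chain_le _ _ _ ps).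
  by rewrite ler_norml => /andP[]; lra.
- by move=> x _; ring.
Qed.

End TotalVariation.
End Chains.

(** * Density of a nondecreasing absolutely continuous function *)

Section Density.
Context {R : realType}.
Local Notation mu := (@lebesgue_measure R).
Variables (F : R -> R) (T : R).
Hypothesis T0 : 0 < T.
Hypothesis Fnd : {in `[0, T] &, nondecreasing_fun F}.
Hypothesis Fac : chain_ac T F.

(** Composing with it extends [F] by constants to the whole line, where a Stieltjes measure can be
    attached. *)
Definition clamp (x : R) : R := Num.max 0 (Num.min x T).

Lemma clampE x : 0 <= x <= T -> clamp x = x.
Proof. by move=> /andP[x0 xT]; rewrite /clamp min_l// max_r. Qed.

Lemma clamp_itv x : 0 <= clamp x <= T.
Proof. by rewrite /clamp le_max lexx/= ge_max (ltW T0)/= ge_min lexx orbT. Qed.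

Lemma clamp_incr x y : x <= y -> 0 <= clamp y - clamp x <= y - x.
Proof.
move=> xy; rewrite /clamp.
have [h1|h1] := leP x T; have [h2|h2] := leP y T;
  try have [h3|h3] := leP 0 x; try have [h4|h4] := leP 0 y;
  try have [h5|h5] := leP 0 T; try lra.
Qed.

Let G x := F (clamp x).

Lemma clamp_nd : nondecreasing G.
Proof.
move=> x y xy; apply: Fnd; rewrite ?in_itv/= ?clamp_itv//.
by have /andP[] := clamp_incr _ _ xy; rewrite subr_ge0.
Qed.

(** A chain of one interval turns [chain_ac] into uniform continuity, as clamping does not lengthen
    intervals. *)
Lemma clamp_rc : right_continuous G.
Proof.
apply: right_continuousW => x; apply/cvgrPdist_le => /= e e0.
have [d d0 H] := Fac e e0.
have near_le y z : y <= z -> z - y < d -> `|G z - G y| <= e.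
  move=> yz zyd; have /andP[c1 c2] := clamp_incr _ _ yz.
  rewrite ger0_norm ?subr_ge0 ?clamp_nd//.
  have := H [:: (clamp y, clamp z)]; rewrite /incr !big_seq1/=; apply.
    by have /andP[? ?] := clamp_itv y; have /andP[? ?] := clamp_itv z; split => //; lra.
  exact: le_lt_trans c2 zyd.
near=> y.
have xyd : `|x - y| < d by near: y; exact: cvgr_dist_lt.
have [xy|yx] := leP x y.
  by rewrite distrC; apply: near_le => //; move: xyd; rewrite ltr_norml => /andP[]; lra.
by apply: near_le; [exact: ltW|move: xyd; rewrite ltr_norml => /andP[]; lra].
Unshelve. all: by end_near. Qed.

HB.instance Definition _ := isCumulative.Build R _ R G clamp_nd clamp_rc.

Let nu : {measure set (measurableTypeR R) -> \bar R} :=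
  lebesgue_stieltjes_measure (G : cumulative R R).

Lemma nu_itv a b : a <= b -> nu `]a, b]%classic = (G b - G a)%:E.
Proof.
move=> ab; rewrite /nu/= /lebesgue_stieltjes_measure /measure_extension/=.
by rewrite measurable_mu_extE/= ?wlength_itv_bnd//; exact: is_ocitv.
Qed.

Definition chain_set (s : seq (R * R)) : set R :=
  [set x | exists2 p, p \in s & p.1 < x <= p.2].

Lemma chain_set_cons p s : chain_set (p :: s) = `]p.1, p.2]%classic `|` chain_set s.
Proof.
apply/seteqP; split => x /=.
  move=> [q]; rewrite inE => /predU1P[->|qs] h; first by left; rewrite /= in_itv.
  by right; exists q.
rewrite in_itv/= => -[h|[q qs h]]; first by exists p; rewrite ?mem_head.
by exists q => //; rewrite inE qs orbT.
Qed.

Lemma chain_set_nil : chain_set [::] = set0.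
Proof. by apply/seteqP; split => x // -[]. Qed.

Lemma measurable_chain_set s : measurable (chain_set s).
Proof.
elim: s => [|p s IH]; first by rewrite chain_set_nil.
by rewrite chain_set_cons; apply: measurableU.
Qed.

(** Intersecting with the interval from [a] to [b] makes the first interval disjoint from the
    remaining ones in the induction. *)
Lemma chain_mu_le (U : set R) a s b : chain a s b -> measurable U ->
  (forall p, p \in s -> `]p.1, p.2] `<=` U) ->
  ((incr id s)%:E <= mu (U `&` `]a, b]))%E.
Proof.
move=> + mU; elim: s a => [|p s IH] a /=.
  by move=> _ _; rewrite /incr big_nil.
move=> [ap pp ps] sU; rewrite /incr big_cons EFinD -/(incr id s).
have pb := chain_le _ _ _ ps.
have pmu : ((p.2 - p.1)%:E <= mu `]p.1, p.2])%E.
  rewrite lebesgue_measure_itv/= lte_fin; case: ltP => // pp'.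
  by rewrite lee_fin subr_le0.
apply: (@le_trans _ _ (mu (`]p.1, p.2] `|` (U `&` `]p.2, b])))).
  rewrite measureU//; last 2 first.
  - exact: measurableI.
  - apply/seteqP; split => x //=; rewrite !in_itv/= => -[/andP[_ xp] [_ /andP[px _]]].
    by move: (lt_le_trans px xp); rewrite ltxx.
  apply: leeD; first exact: pmu.
  by apply: IH ps _ => q qs; apply: sU; rewrite inE qs orbT.
apply: le_measure; rewrite ?inE; [|exact: measurableI|].
  by apply: measurableU => //; exact: measurableI.
move=> x [/= xp|[Ux]].
  split; first by apply: (sU p _ x xp); rewrite mem_head.
  move: xp; rewrite /= !in_itv/= => /andP[px xp].
  by rewrite (le_lt_trans ap px) (le_trans xp pb).
rewrite /= !in_itv/= => /andP[px xb]; split => //.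
by rewrite xb (le_lt_trans (le_trans ap pp) px).
Qed.

Lemma chain_nu_le a s b : chain a s b -> (nu (chain_set s) <= (incr G s)%:E)%E.
Proof.
elim: s a => [|p s IH] a /=.
  by move=> _; rewrite chain_set_nil measure0 /incr big_nil.
move=> [ap pp ps]; rewrite chain_set_cons /incr big_cons EFinD -/(incr G s).
apply: le_trans (_ : _ <= nu `]p.1, p.2]%classic + nu (chain_set s))%E _.
  by apply: measureU2 => //; exact: measurable_chain_set.
by rewrite -nu_itv// leeD2l// (IH p.2).
Qed.

Lemma incr_clamp a s b : 0 <= a -> b <= T -> chain a s b -> incr G s = incr F s.
Proof.
move=> a0 bT; elim: s a a0 => [|p s IH] a a0 /=; first by rewrite /incr !big_nil.
move=> [ap pp ps]; have pb := chain_le _ _ _ ps.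
rewrite /incr !big_cons -!/(incr _ s) (IH p.2)//; last first.
  exact: le_trans a0 (le_trans ap pp).
by rewrite /G !clampE//; apply/andP; split; lra.
Qed.

Section Grid.
Variable U : set R.
Hypothesis oU : open U.

Let h (m : nat) : R := T / (2 ^ m)%N%:R.

Lemma grid_gt0 m : 0 < h m.
Proof. by rewrite divr_gt0// ltr0n expn_gt0. Qed.

Let gridI m (k : nat) : set R := `]k%:R * h m, k.+1%:R * h m]%classic.

(* The dyadic intervals of level m contained in U form an ordered chain; this
   avoids decomposing the open set U into components. *)
Definition grid m : seq (R * R) :=
  [seq (k%:R * h m, k.+1%:R * h m) | k <- iota 0 (2 ^ m) & `[< gridI m k `<=` U >]].

Lemma gridP m x : chain_set (grid m) x <->
  exists k, [/\ (k < 2 ^ m)%N, gridI m k x & gridI m k `<=` U].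
Proof.
split.
  move=> [_ /mapP[k + ->]]; rewrite mem_filter mem_iota/= add0n => /andP[/asboolP kU km] xk.
  by exists k; split => //; rewrite /gridI/= in_itv.
move=> [k [km xk kU]]; exists (k%:R * h m, k.+1%:R * h m).
  apply/mapP; exists k => //; rewrite mem_filter mem_iota/= add0n km andbT.
  exact/asboolP.
by move: xk; rewrite /gridI/= in_itv.
Qed.

Lemma chain_grid m : chain 0 (grid m) T.
Proof.
suff key i n : chain (i%:R * h m)
    [seq (k%:R * h m, k.+1%:R * h m) | k <- iota i n & `[< gridI m k `<=` U >]]
    ((i + n)%:R * h m).
  have hT : (2 ^ m)%N%:R * h m = T.
    by rewrite /h mulrCA divff ?mulr1// pnatr_eq0 expn_eq0.
  by have := key 0%N (2 ^ m)%N; rewrite mul0r add0n hT.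
elim: n i => [|n IH] i /=; first by rewrite addn0.
have ii : i%:R * h m <= i.+1%:R * h m.
  by rewrite ler_pM2r ?grid_gt0// ler_nat.
have := IH i.+1; rewrite addSnnS; case: asboolP => /= _; last exact: chain_lel.
by split.
Qed.

Lemma grid_nd m : chain_set (grid m) `<=` chain_set (grid m.+1).
Proof.
move=> x /gridP[k [km xk kU]]; apply/gridP.
have hS : h m = 2 * h m.+1.
  by rewrite /h expnS natrM; field; rewrite pnatr_eq0 expn_eq0.
have h0 := grid_gt0 m.+1.
have sub k' : (k' == k.*2) || (k' == k.*2.+1) -> gridI m.+1 k' `<=` gridI m k.
  move=> kk y; rewrite /gridI/= !in_itv/= hS => /andP[y1 y2].
  case/orP: kk y1 y2 => /eqP ->; rewrite -?natr1 -muln2 natrM => y1 y2;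
    by apply/andP; split; nra.
have [xm|xm] := leP x (k.*2.+1%:R * h m.+1).
  exists k.*2; split.
  - by rewrite expnS mul2n ltn_double.
  - move: xk; rewrite /gridI/= !in_itv/= xm andbT => /andP[+ _].
    by rewrite hS -muln2 natrM mulrA.
  - by apply: subset_trans kU; apply: sub; rewrite eqxx.
exists k.*2.+1; split.
- by rewrite expnS mul2n -doubleS leq_double.
- move: xk; rewrite /gridI/= !in_itv/= xm/= => /andP[_].
  by rewrite hS -doubleS -muln2 natrM mulrA.
- by apply: subset_trans kU; apply: sub; rewrite eqxx orbT.
Qed.

Lemma grid_cover : U `&` `]0, T] `<=` \bigcup_m chain_set (grid m).
Proof.
move=> x [Ux]; rewrite /= in_itv/= => /andP[x0 xT].
have /nbhs_ballP[e /= e0 eU] : nbhs x U by exact: open_nbhs_nbhs.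
(* The mesh [T / 2 ^ m] is then below the radius [e], because [2 ^ m] exceeds [m]. *)
pose m := Num.bound (T / e).
have hme : h m < e.
  rewrite /h ltr_pdivrMr ?ltr0n ?expn_gt0// mulrC -ltr_pdivrMr//.
  have := archi_boundP (divr_ge0 (ltW T0) (ltW e0)); move/lt_le_trans; apply.
  by rewrite ler_nat ltnW// ltn_expl.
have h0 := grid_gt0 m.
have hT : (2 ^ m)%N%:R * h m = T.
  by rewrite /h mulrCA divff ?mulr1// pnatr_eq0 expn_eq0.
have ex : exists j, x <= j%:R * h m by exists (2 ^ m)%N; rewrite hT.
(* The least grid point not below [x] is the right end of the grid interval containing [x]; it is
   not [0] because [x] is positive. *)
case: (ex_minnP ex) => -[|k] xk kmin; first by move: xk; rewrite mul0r leNgt x0.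
have kx : k%:R * h m < x by rewrite ltNge; apply/negP => /kmin; rewrite ltnn.
exists m => //; apply/gridP; exists k; split.
- by apply: kmin; rewrite hT.
- by rewrite /gridI/= in_itv/= kx.
move=> y; rewrite /gridI/= in_itv/= -natr1 mulrDl mul1r => /andP[ky yk].
apply: eU; rewrite /ball/= ltr_norml.
by move: xk; rewrite -natr1 mulrDl mul1r => xk; apply/andP; split; lra.
Qed.

(** Each grid is a chain of length at most [mu U < d], hence of [nu]-measure at most [e]. The grids
    increase and cover [U] within the interval, so continuity from below finishes. *)
Lemma nu_open_le (e d : R) :
  (forall s, chain 0 s T -> incr id s < d -> incr F s <= e) ->
  (mu U < d%:E)%E -> (nu (U `&` `]0%R, T]) <= e%:E)%E.
Proof.
move=> H Ud.
have mU : measurable U by exact: open_measurable.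
have mc m : measurable (chain_set (grid m)) by exact: measurable_chain_set.
have mB : measurable (\bigcup_m chain_set (grid m)) by exact: bigcupT_measurable.
apply: (@le_trans _ _ (nu (\bigcup_m chain_set (grid m)))).
  by apply: le_measure; rewrite ?inE//; [exact: measurableI|exact: grid_cover].
have nd : nondecreasing_seq (fun m => chain_set (grid m)).
  by apply/nondecreasing_seqP => m; apply/subsetPset; exact: grid_nd.
have cv := @nondecreasing_cvg_mu _ _ _ nu _ mc mB nd.
apply: (cvge_to_le cv); apply: nearW => m /=.
apply: (le_trans (chain_nu_le _ _ _ (chain_grid m))).
rewrite (incr_clamp _ _ _ _ _ (chain_grid m))// lee_fin; apply: H; first exact: chain_grid.
rewrite -lte_fin; apply: le_lt_trans Ud.
apply: (le_trans (chain_mu_le U _ _ _ (chain_grid m) mU _)).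
  move=> p /mapP[k]; rewrite mem_filter => /andP[/asboolP kU _] ->.
  exact: kU.
by apply: le_measure; rewrite ?inE//; exact: measurableI.
Qed.

End Grid.

(** Outer regularity encloses [A] in an open set of Lebesgue measure below the [delta] of
    [chain_ac]. *)
Lemma nu_null (A : set R) : measurable A -> mu A = 0%E -> nu (A `&` `]0, T]) = 0%E.
Proof.
move=> mA A0; apply/eqP; rewrite eq_le measure_ge0 andbT.
apply/lee_addgt0Pr => e e0; rewrite add0e.
have [d d0 H] := Fac e e0.
have [|U [oU AU UA]] := @lebesgue_regularity_outer R A d mA _ d0.
  have A0' : (mu A <= 0)%E by rewrite A0.
  exact: le_lt_trans A0' (ltry 0).
have mU : measurable U by exact: open_measurable.
apply: (@le_trans _ _ (nu (U `&` `]0%R, T]))).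
  apply: le_measure; rewrite ?inE; [exact: measurableI|exact: measurableI|].
  exact: setSI.
apply: nu_open_le H _ => //.
have UA' : (mu (U `\` A) + mu A < d%:E)%E by rewrite A0 adde0.
rewrite (_ : U = (U `\` A) `|` A); last by rewrite setDKU.
by apply: le_lt_trans UA'; apply: measureU2 => //; exact: measurableD.
Qed.

Lemma chain_ac_integral : exists W : R -> \bar R,
  [/\ measurable_fun setT W, forall x, (0 <= W x)%E, forall x, x <= 0 -> W x = 0%E,
      (\int[mu]_x W x < +oo)%E &
      forall x, 0 <= x <= T -> (\int[mu]_(s in `]-oo, x]) W s)%E = (F x - F 0)%:E].
Proof.
have mD : measurable (`]0, T] : set (measurableTypeR R)) by [].
have moo : (nu `]0%R, T]%classic < +oo)%E by rewrite nu_itv ?ltry// ltW.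
pose nu' := mfrestr mD moo.
have numu : nu' `<< mu.
  move=> N N0 A mA AN; rewrite /nu' /mfrestr /mrestr; apply: nu_null => //.
  exact: N0.
pose f := Radon_Nikodym_SigmaFinite.f nu' mu.
have f0 : forall x, (0 <= f x)%E by exact: Radon_Nikodym_SigmaFinite.f_ge0.
have fi : mu.-integrable setT f by exact: Radon_Nikodym_SigmaFinite.f_integrable.
have mf : measurable_fun setT f by exact: measurable_int fi.
have fE A : measurable A -> (\int[mu]_(x in A) f x)%E = nu (A `&` `]0%R, T]).
  by move=> mA; rewrite -Radon_Nikodym_SigmaFinite.f_integral.
exists (f \_ `]0, T]); split.
- by apply/(measurable_restrictT _ _).1 => //; exact: measurable_funTS.
- by move=> x; rewrite patchE; case: ifP.
- by move=> x x0; rewrite patchE mem_setE in_itv/= ltNge x0.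
- rewrite -integral_mkcond fE// setIid nu_itv ?ltry//; exact: ltW.
- move=> x /andP[x0 xT]; rewrite -integral_mkcondr fE; last exact: measurableI.
  rewrite (_ : _ `&` _ = `]0, x]%classic).
    by rewrite nu_itv// /G !clampE ?x0 ?lexx ?(ltW T0).
  apply/seteqP; split => y /=; rewrite !in_itv/=; first by move=> [[-> /andP[->]]].
  by move=> /andP[y0 yx]; rewrite yx y0 (le_trans yx xT).
Qed.

End Density.

(** [W1 - W2] plays the part of the derivative of [u]; keeping two nonnegative densities lets
    Tonelli's theorem apply to each. *)
Lemma abs_cont_integral (R : realType) (u : R -> R) (T : R) : 0 < T ->
  abs_cont_on u 0 T -> exists W1 W2 : R -> \bar R,
  [/\ measurable_fun setT W1 /\ measurable_fun setT W2,
      (forall x, (0 <= W1 x)%E) /\ (forall x, (0 <= W2 x)%E),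
      forall x, x <= 0 -> W1 x = 0%E /\ W2 x = 0%E,
      (\int[lebesgue_measure]_x W1 x < +oo)%E /\ (\int[lebesgue_measure]_x W2 x < +oo)%E &
      forall x, 0 <= x <= T -> u x = u 0 +
        fine (\int[lebesgue_measure]_(s in `]-oo, x]) W1 s) -
        fine (\int[lebesgue_measure]_(s in `]-oo, x]) W2 s)].
Proof.
move=> T0 uac; have [F [G [Fnd Gnd Fac Gac uE]]] := abs_cont_monotone_diff u T T0 uac.
have [W1 [m1 p1 z1 i1 e1]] := chain_ac_integral F T T0 Fnd Fac.
have [W2 [m2 p2 z2 i2 e2]] := chain_ac_integral G T T0 Gnd Gac.
exists W1, W2; split => //.
- by move=> x x0; split; [exact: z1|exact: z2].
move=> x xT; rewrite e1// e2// uE//= (uE 0) ?lexx ?ltW//; ring.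
Qed.

(** * The Sonine pair *)

Section StieltjesSign.
Context {R : realType}.
Local Notation mu := (@lebesgue_measure R).

Lemma cm_upto_integral d (T : measurableType d) (nu : {measure set T -> \bar R})
    (D : set T) (w : nat -> T -> R) n : measurable D ->
  (forall i, nu.-integrable D (EFin \o w i)) ->
  (forall t, D t -> cm_upto n (w^~ t)) ->
  cm_upto n (fun i => Rintegral nu D (w i)).
Proof.
move=> mD; elim: n w => [|n IH] w wi wcm; split => //.
- by move=> i; apply: Rintegral_ge0 => t /wcm /cm_upto_ge0.
- by move=> i; apply: Rintegral_ge0 => t /wcm /cm_upto_ge0.
rewrite (_ : Delta _ = fun i => Rintegral nu D (fun t => w i t - w i.+1 t)).
  apply: IH => [i|t Dt].
    by have := integrableB mD (wi i) (wi i.+1); apply: eq_integrable.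
  by have [] := wcm t Dt.
by apply/funext => i; rewrite /Delta RintegralB.
Qed.

(** Here [p * phi p] is [a + b * p] plus the integral of [p / (p + t)]. In its increments [a]
    cancels, [b] becomes a constant, and [cm_upto_incr] treats the integrand. *)
Lemma stieltjes_cm (phi : R -> R) n : stieltjes phi ->
  cm_upto n (fun i => i.+2%:R * phi i.+2%:R - i.+1%:R * phi i.+1%:R).
Proof.
move=> [a [b [sigma [a0 b0 s1 phiE]]]].
have mshift i : measurable_fun (`[0, +oo[ : set R) (fun t : R => (i.+1%:R + t)^-1).
  have : measurable_fun (`[0, +oo[ : set R) (fun t : R => (i.+1%:R + t) `^ (-1)).
    by apply: (measurableT_comp (measurable_powR _)); apply: measurable_funD.
  apply: eq_measurable_fun => t; rewrite inE/= in_itv/= andbT => t0.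
  by rewrite powR_inv1// addr_ge0.
have i1 : sigma.-integrable `[0, +oo[ (EFin \o (fun t : R => (1 + t)^-1)).
  apply/integrableP; split; first by apply/measurable_EFinP; exact: (mshift 0%N).
  rewrite (eq_integral (fun t : R => ((1 + t)^-1)%:E))// => t.
  by rewrite inE/= in_itv/= andbT => t0; rewrite ger0_norm// invr_ge0 addr_ge0.
have ii i : sigma.-integrable `[0, +oo[ (EFin \o (fun t : R => (i.+1%:R + t)^-1)).
  apply: le_integrable i1 => //; first exact/measurable_EFinP.
  move=> t /=; rewrite in_itv/= andbT => t0; rewrite lee_fin.
  rewrite !ger0_norm ?invr_ge0 ?addr_ge0// lef_pV2 ?posrE ?ltr_pwDl//.
  by rewrite lerD2r ler1n.
pose w i (t : R) := i.+1%:R / (i.+1%:R + t).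
have wi i : sigma.-integrable `[0, +oo[ (EFin \o w i).
  have := integrableZl _ i.+1%:R (ii i).
  by move=> /(_ (measurable_itv _)); apply: eq_integrable.
have E i : i.+1%:R * phi i.+1%:R =
    a + b * i.+1%:R + Rintegral sigma `[0, +oo[ (w i).
  have -> : phi i.+1%:R = a / i.+1%:R + b +
      Rintegral sigma `[0, +oo[ (fun t : R => (i.+1%:R + t)^-1).
    apply: EFin_inj; rewrite EFinD phiE//; congr (_ + _)%E.
    by rewrite /Rintegral fineK//; apply: integrable_fin_num => //; exact: ii.
  rewrite mulrDr -RintegralZl//; congr (_ + _).
  by field; rewrite gt_eqF.
rewrite (_ : (fun i => _) = fun i =>
    b + Rintegral sigma `[0, +oo[ (fun t => w i.+1 t - w i t)); last first.
  apply/funext => i; rewrite !E RintegralB// -[i.+2%:R]natr1; ring.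
apply: cm_uptoD; first exact: cm_upto_cst.
apply: (cm_upto_integral _ _ _ _ (fun i t => w i.+1 t - w i t)) => //.
  move=> i; have := integrableB (measurable_itv _) (wi i.+1) (wi i).
  by apply: eq_integrable.
move=> t; rewrite /= in_itv/= andbT => t0; exact: cm_upto_incr.
Qed.

Lemma sonine_dual_ge0 (k varkappa : R -> R) :
  stieltjes (laplace k) ->
  (forall p : R, 0 < p -> 0 < laplace k p) ->
  (forall p : R, 0 < p -> laplace_exists varkappa p) ->
  (forall p : R, 0 < p -> laplace varkappa p = (p * laplace k p)^-1) ->
  {ae mu, forall t : R, 0 < t -> 0 <= varkappa t}.
Proof.
move=> sk kp lv vE; apply: laplace_cm_ge0 => // l m.
suff: cm_upto l (fun m : nat => laplace varkappa m.+1%:R).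
  by move/cm_upto_iter => /(_ l (leqnn l) m).
rewrite (_ : (fun _ => _) = fun m : nat => (m.+1%:R * laplace k m.+1%:R)^-1).
  apply: cm_uptoV => [i|]; first by rewrite mulr_gt0// kp.
  exact: stieltjes_cm.
by apply/funext => i; rewrite vE.
Qed.

(** The transform is nonnegative and nonincreasing, so a zero at [p] would persist at all [q > p],
    against the growth of [q * laplace k q]. *)
Lemma laplace_gt0 (k : R -> R) :
  (forall t : R, 0 < t -> 0 <= k t) ->
  (forall p : R, 0 < p -> laplace_exists k p) ->
  p * laplace k p @[p --> +oo] --> +oo ->
  forall p : R, 0 < p -> 0 < laplace k p.
Proof.
move=> k0 lk koo p p0.
have lk0 q : 0 <= laplace k q.
  apply: Rintegral_ge0 => t /=; rewrite in_itv/= andbT => t0.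
  by rewrite mulr_ge0 ?expR_ge0// k0.
rewrite lt_neqAle lk0 andbT; apply/negP => /eqP kp0.
have [q [pq q1]] : exists q, p < q /\ 1 <= q * laplace k q.
  have /cvgryPge /(_ 1) H := koo.
  near (pinfty_nbhs R) => q; exists q; split; near: q => //.
  by apply: nbhs_pinfty_gt; exact: num_real.
have kq0 : laplace k q <= 0.
  rewrite [leRHS]kp0; apply: le_Rintegral => //; [exact: lk (lt_trans p0 pq)|exact: lk|].
  move=> t /=; rewrite in_itv/= andbT => t0.
  by rewrite ler_wpM2r ?k0// ler_expR lerN2 ler_pM2r// ltW.
have := le_lt_trans (mulr_ge0_le0 (ltW (lt_trans p0 pq)) kq0) (lt_le_trans ltr01 q1).
by rewrite ltxx.
Unshelve. all: by end_near. Qed.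

End StieltjesSign.

(** * Causal functions, their convolutions and Laplace transforms *)

Section Sonine.
Context {R : realType}.
Local Notation mu := (@lebesgue_measure R).
Local Open Scope ereal_scope.

Implicit Types F G : R -> \bar R.

Lemma laplace_exists_measurable (g : R -> R) (p : R) : laplace_exists g p ->
  measurable_fun (`]0%R, +oo[ : set R) g.
Proof.
move=> /measurable_int /measurable_EFinP mg.
rewrite (_ : g = fun t => (expR (p * t) * (expR (- (p * t)) * g t))%R).
  apply: measurable_funM => //; apply: measurable_funTS.
  by apply: measurableT_comp => //; exact: measurable_funM.
by apply/funext => t; rewrite mulrA -expRD subrr expR0 mul1r.
Qed.

(* Taking the positive part makes Tonelli applicable without exceptional sets;
   for [varkappa] it only changes a null set. *)
Definition causal (g : R -> R) (t : R) : \bar R :=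
  if (0 < t)%R then (Num.max (g t) 0)%:E else 0.

Lemma subr_max0 (x : R) : (Num.max x 0 - Num.max (- x) 0)%R = x.
Proof.
have [h|h] := leP x 0%R; first by rewrite max_l ?oppr_ge0//; ring.
by rewrite max_r ?oppr_le0 ?(ltW h)//; ring.
Qed.

Lemma causal_ge0 g t : 0 <= causal g t.
Proof. by rewrite /causal; case: ifPn => // _; rewrite lee_fin le_max lexx orbT. Qed.

Lemma causal_fin_num g t : causal g t \is a fin_num.
Proof. by rewrite /causal; case: ifPn. Qed.

Lemma causal_le0 g t : (t <= 0)%R -> causal g t = 0.
Proof. by rewrite /causal ltNge => ->. Qed.

Lemma causalE g t : (0 < t)%R -> (0 <= g t)%R -> causal g t = (g t)%:E.
Proof. by rewrite /causal => -> g0; rewrite max_l. Qed.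

Lemma measurable_causal g : measurable_fun (`]0%R, +oo[ : set R) g ->
  measurable_fun setT (causal g).
Proof.
move=> mg.
rewrite (_ : causal g = (EFin \o (g \max cst 0%R)) \_ `]0%R, +oo[).
  apply/(measurable_restrictT _ _).1 => //.
  by apply/measurable_EFinP; exact: measurable_maxr.
by apply/funext => t; rewrite /causal patchE mem_setE in_itv/= andbT.
Qed.

Definition heaviside (t : R) : \bar R := causal (fun=> 1%R) t.

Lemma measurable_heaviside : measurable_fun setT heaviside.
Proof. exact: measurable_causal. Qed.

Lemma conv_heaviside F t : conv heaviside F t = \int[mu]_(s in `]-oo, t]) F s.
Proof.
rewrite [RHS]integral_mkcond /conv; apply: integral_ae.
apply: ae_impl (ae_neq t) => s st _.
rewrite patchE mem_setE in_itv/= le_eqVlt (introF eqP st)/= /heaviside /causal.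
by rewrite subr_gt0; case: ifPn => _; rewrite ?mul0e// max_l ?mul1e.
Qed.

Lemma conv_le0 F G t : (forall s, (s <= 0)%R -> F s = 0) ->
  (forall s, (s <= 0)%R -> G s = 0) -> (t <= 0)%R -> conv F G t = 0.
Proof.
move=> F0 G0 t0; rewrite /conv; apply: integral0_eq => s _.
have [s0|s0] := leP s 0%R; first by rewrite G0// mule0.
by rewrite F0 ?mul0e// subr_le0 (le_trans t0)// ltW.
Qed.

Definition expw (p : R) F (t : R) : \bar R := (expR (- (p * t)))%:E * F t.

Lemma expw_ge0 p F t : 0 <= F t -> 0 <= expw p F t.
Proof. by move=> F0; rewrite mule_ge0// lee_fin expR_ge0. Qed.

Lemma measurable_expw p F : measurable_fun setT F -> measurable_fun setT (expw p F).
Proof.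
move=> mF; apply: emeasurable_funM => //.
apply/measurable_EFinP; apply: measurableT_comp => //.
by apply: measurableT_comp => //; exact: measurable_funM.
Qed.

(** The convolution theorem: the exponential weight splits over [t - s] and [s], so it commutes with
    [conv]. *)
Lemma integral_expw_conv p F G :
  measurable_fun setT F -> measurable_fun setT G ->
  (forall x, 0 <= F x) -> (forall x, 0 <= G x) ->
  \int[mu]_t expw p (conv F G) t = (\int[mu]_t expw p F t) * \int[mu]_t expw p G t.
Proof.
move=> mF mG F0 G0; rewrite -integral_conv; last 4 first.
- exact: measurable_expw.
- exact: measurable_expw.
- by move=> x; exact: expw_ge0.
- by move=> x; exact: expw_ge0.
apply: eq_integral => t _; rewrite /expw /conv -ge0_integralZl_EFin//.
- apply: eq_integral => s _; rewrite muleACA -EFinM -expRD.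
  by congr ((expR _)%:E * _); ring.
- by move=> s _; exact: mule_ge0.
- by apply: emeasurable_funM => //; exact: measurableT_comp mF (measurable_subl _).
Qed.

Lemma integral_expw_causal (g : R -> R) p : laplace_exists g p ->
  {ae mu, forall t, (0 < t)%R -> (0 <= g t)%R} ->
  \int[mu]_t expw p (causal g) t = (laplace g p)%:E.
Proof.
move=> lg g0; rewrite /laplace /Rintegral fineK; last first.
  exact: integrable_fin_num.
rewrite [RHS]integral_mkcond; apply: integral_ae; apply: ae_impl g0 => t gt0 _.
rewrite patchE mem_setE in_itv/= andbT /expw.
have [t0|t0] := ltP 0%R t; last by rewrite causal_le0// mule0.
by rewrite causalE// gt0.
Qed.

(** Up to the factor [p] the integrand is the exponential probability density. *)
Lemma integral_expw_heaviside p : (0 < p)%R -> \int[mu]_t expw p heaviside t = (p^-1)%:E.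
Proof.
move=> p0; have := integral_exponential_pdf p0.
rewrite (_ : \int[mu]_x _ = p%:E * \int[mu]_t expw p heaviside t).
  move=> e; rewrite -[LHS]mul1e -[in LHS](_ : (p^-1)%:E * p%:E = 1) -?muleA ?e ?mule1//.
  by rewrite -EFinM mulVf// gt_eqF.
rewrite -ge0_integralZl_EFin//.
- apply: integral_ae; apply: ae_impl (ae_neq 0%R) => t t0 _.
  rewrite /exponential_pdf patchE mem_setE in_itv/= andbT /expw /heaviside /causal.
  rewrite le_eqVlt eq_sym (introF eqP t0)/=.
  case: ifPn => _; rewrite ?mule0// max_l// mule1 -EFinM mulNr//.
- by move=> t _; apply: expw_ge0; exact: causal_ge0.
- by apply: measurable_expw; exact: measurable_heaviside.
- exact: ltW.
Qed.

(** For [s <= t] one has [1 <= expR (t - s)], so the primitive is bounded by [expR t] times an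
    absolutely convergent Laplace integral. *)
Lemma conv_heaviside_causal_lty (g : R -> R) t : laplace_exists g 1 ->
  conv heaviside (causal g) t < +oo.
Proof.
move=> lg; have mg := laplace_exists_measurable _ _ lg.
have mabs : measurable_fun (`]0%R, +oo[ : set R)
    (fun s : R => `|(expR (- (1 * s)) * g s)%:E|).
  by apply: measurableT_comp => //; exact: measurable_int lg.
have [_ goo] := integrableP _ _ _ lg.
rewrite conv_heaviside integral_mkcond.
apply: (@le_lt_trans _ _ ((expR t)%:E *
    \int[mu]_(s in `]0%R, +oo[) `|(expR (- (1 * s)) * g s)%:E|)); last first.
  by rewrite lte_mul_pinfty// lee_fin expR_ge0.
rewrite -ge0_integralZl_EFin//.
rewrite [leRHS]integral_mkcond; apply: ge0_le_integral => //.
- by move=> s _; rewrite patchE; case: ifPn => // _; exact: causal_ge0.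
- apply/(measurable_restrictT _ _).1 => //; apply: measurable_funTS.
  exact: measurable_causal.
- apply/(measurable_restrictT _ _).1 => //; exact: emeasurable_funM.
move=> s _; rewrite !patchE !mem_setE !in_itv/= andbT.
have [s0|s0] := ltP 0%R s; last first.
  by rewrite causal_le0//; case: ifP.
case: ifPn => [st|_]; last by rewrite -EFinM lee_fin mulr_ge0// expR_ge0.
rewrite /causal s0 -EFinM lee_fin normrM ger0_norm ?expR_ge0//.
rewrite mulrA -expRD mul1r.
apply: (@le_trans _ _ `|g s|%R); first by rewrite ge_max ler_norm normr_ge0.
by rewrite ler_peMl// -expR0 ler_expR subr_ge0.
Qed.

Lemma conv_le_cst F G (M : R) t : measurable_fun setT F -> measurable_fun setT G ->
  (forall x, 0 <= F x) -> (forall x, 0 <= G x) -> (0 <= M)%R ->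
  (forall s, (s <= t)%R -> F s <= M%:E) -> (forall s, (s <= 0)%R -> G s = 0) ->
  conv F G t <= M%:E * \int[mu]_s G s.
Proof.
move=> mF mG F0 G0 M0 FM Gle0; rewrite -ge0_integralZl_EFin//.
apply: ge0_le_integral => //.
- by move=> s _; exact: mule_ge0.
- by apply: emeasurable_funM => //; exact: measurableT_comp mF (measurable_subl _).
- exact: emeasurable_funM.
move=> s _; have [s0|s0] := leP s 0%R; first by rewrite Gle0// !mule0.
by apply: lee_wpmul2r => //; apply: FM; rewrite gerBl ltW.
Qed.

Lemma le_conv_heaviside F s t : measurable_fun setT F -> (forall x, 0 <= F x) ->
  (s <= t)%R -> conv heaviside F s <= conv heaviside F t.
Proof.
move=> mF F0 st; rewrite !conv_heaviside; apply: ge0_subset_integral => //.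
  exact: measurable_funTS.
by move=> x /=; rewrite !in_itv/= => /le_trans; exact.
Qed.

(** The bridge from the real convolution to [conv]. Finiteness of both convolutions makes the real
    integral a genuine one, and [u] need only be known almost everywhere. *)
Lemma kconvE (g u : R -> R) (U1 U2 : R -> \bar R) (t : R) :
  {ae mu, forall s, (0 < s)%R -> (0 <= g s)%R} ->
  measurable_fun (`]0%R, +oo[ : set R) g ->
  measurable_fun setT U1 -> measurable_fun setT U2 ->
  (forall s, 0 <= U1 s) -> (forall s, 0 <= U2 s) ->
  (forall s, (s <= 0)%R -> U1 s = 0) -> (forall s, (s <= 0)%R -> U2 s = 0) ->
  conv (causal g) U1 t < +oo -> conv (causal g) U2 t < +oo ->
  {ae mu, forall s, (0 < s < t)%R -> [/\ U1 s \is a fin_num, U2 s \is a fin_num &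
    u s = (fine (U1 s) - fine (U2 s))%R]} ->
  kconv g u t = (fine (conv (causal g) U1 t) - fine (conv (causal g) U2 t))%R.
Proof.
move=> g0 mg mU1 mU2 U10 U20 U1le U2le c1 c2 uE.
have mG : measurable_fun setT (causal g) by exact: measurable_causal.
have G0 := causal_ge0 g.
have mA (U : R -> \bar R) : measurable_fun setT U ->
    measurable_fun setT (fun s : R => causal g (t - s)%R * U s).
  move=> mU; apply: emeasurable_funM => //.
  exact: measurableT_comp mG (measurable_subl _).
have A0 (U : R -> \bar R) : (forall s, 0 <= U s) -> forall s, 0 <= causal g (t - s)%R * U s.
  by move=> U0 s; exact: mule_ge0.
have [i1 e1] := fine_integral _ _ _ mu _ _ measurableT (mA _ mU1) (A0 _ U10) c1.
have [i2 e2] := fine_integral _ _ _ mu _ _ measurableT (mA _ mU2) (A0 _ U20) c2.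
rewrite /conv -e1 -e2 -RintegralB// /kconv Rintegral_mkcond.
rewrite /Rintegral; congr fine; apply: integral_ae.
(* The endpoints are discarded: [kconv] integrates over a closed interval, while causal functions
   vanish at [0]. *)
apply: ae_impl2 (ae_neq 0%R) (ae_and (ae_neq t) (ae_and uE (ae_subl _ t g0))).
move=> s s0 [st [us gs]] _; congr EFin.
rewrite patchE mem_setE in_itv/= !le_eqVlt eq_sym (introF eqP s0) (introF eqP st)/=.
have [s0'|s0'] := ltP 0%R s; last by rewrite U1le// U2le// mule0 subrr.
have [st'|st'] := ltP s t; last by rewrite causal_le0 ?mul0e ?subrr// subr_le0.
have [|f1 f2 ->] := us; first by rewrite s0'.
have ts : (0 < t - s)%R by rewrite subr_gt0.
by rewrite causalE ?gs// !fineM// mulrBr.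
Qed.

(** * The Sonine identity and the two inversion formulas *)

Section Pair.
Variables k varkappa : R -> R.
Hypothesis k0 : forall t : R, (0 < t)%R -> (0 <= k t)%R.
Hypothesis v0 : {ae mu, forall t : R, (0 < t)%R -> (0 <= varkappa t)%R}.
Hypothesis lk : forall p : R, (0 < p)%R -> laplace_exists k p.
Hypothesis lv : forall p : R, (0 < p)%R -> laplace_exists varkappa p.
Hypothesis kp : forall p : R, (0 < p)%R -> (0 < laplace k p)%R.
Hypothesis vE : forall p : R, (0 < p)%R -> laplace varkappa p = ((p * laplace k p)^-1)%R.

Lemma sonine_conv : {ae mu, forall t, conv (causal varkappa) (causal k) t = heaviside t}.
Proof.
set V := causal varkappa; set K := causal k.
have mK : measurable_fun setT K.
  by apply: measurable_causal; exact: laplace_exists_measurable (lk _ ltr01).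
have mV : measurable_fun setT V.
  by apply: measurable_causal; exact: laplace_exists_measurable (lv _ ltr01).
have V0 : forall x, 0 <= V x by exact: causal_ge0.
have K0 : forall x, 0 <= K x by exact: causal_ge0.
pose C := conv V K.
have C0 t : 0 <= C t by exact: conv_ge0.
have mC : measurable_fun setT C by exact: measurable_conv.
have CE p : (0 < p)%R -> \int[mu]_t expw p C t = (p^-1)%:E.
  move=> p0; rewrite integral_expw_conv// !integral_expw_causal//; last first.
    - exact: lv.
    - by apply: aeW.
    - exact: lk.
  by rewrite vE// -EFinM; congr EFin; field; rewrite !gt_eqF ?kp.
have Cle0 t : (t <= 0)%R -> C t = 0 by apply: conv_le0 => s; exact: causal_le0.
(* This holds at infinite [x] too, where both sides take the default value [0]. *)
have fineZ (r : R) (x : \bar R) : (0 < r)%R -> fine (r%:E * x) = (r * fine x)%R.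
  move=> r0; case: x => [x||] //=; rewrite ?gt0_muley ?gt0_muleNy ?lte_fin//=.
    by rewrite mulr0.
  by rewrite mulr0.
have fexpw F p : measurable_fun setT F -> (forall t, 0 <= F t) ->
    (forall t, (t <= 0)%R -> F t = 0) -> \int[mu]_t expw p F t = (p^-1)%:E ->
    mu.-integrable `]0%R, +oo[ (EFin \o (fun t => expR (- (p * t)) * fine (F t)))%R /\
    Rintegral mu `]0%R, +oo[ (fun t => expR (- (p * t)) * fine (F t))%R = p^-1%R.
  move=> mF F0 Fle0 FE.
  have [i e] : mu.-integrable setT (EFin \o (fine \o expw p F)) /\
      Rintegral mu setT (fine \o expw p F) = fine (\int[mu]_t expw p F t).
    apply: fine_integral => //; first exact: measurable_expw.
    - by move=> x; exact: expw_ge0.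
    - by rewrite FE ltry.
  have E t : fine (expw p F t) = (expR (- (p * t)) * fine (F t))%R.
    by rewrite /expw fineZ// expR_gt0.
  split.
    have : mu.-integrable `]0%R, +oo[ (EFin \o (fine \o expw p F)).
      exact: integrableS i.
    by apply: eq_integrable => // t _ /=; rewrite E.
  rewrite -[RHS]/(fine (p^-1)%:E) -FE -e Rintegral_mkcond.
  apply: eq_Rintegral => t _; rewrite patchE mem_setE in_itv/= andbT E.
  by case: ltP => // t0; rewrite Fle0// mulr0.
have mone := measurable_heaviside.
have one0 t : 0 <= heaviside t by exact: causal_ge0.
have onele0 t : (t <= 0)%R -> heaviside t = 0 by exact: causal_le0.
pose h t := (fine (C t) - 1)%R.
have hE p t : (0 < t)%R -> (expR (- (p * t)) * h t =
    expR (- (p * t)) * fine (C t) - expR (- (p * t)) * fine (heaviside t))%R.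
  by move=> t0; rewrite /heaviside /causal t0/= max_l// mulrBr.
have lh p : (0 < p)%R -> laplace_exists h p.
  move=> p0; have [i1 _] := fexpw C p mC C0 Cle0 (CE p p0).
  have [i2 _] := fexpw heaviside p mone one0 onele0 (integral_expw_heaviside p p0).
  have := integrableB _ i1 i2; move=> /(_ (measurable_itv _)).
  apply: eq_integrable => // t; rewrite inE/= in_itv/= andbT => t0.
  by rewrite hE// EFinB.
have lh0 p : (0 < p)%R -> laplace h p = 0%R.
  move=> p0; have [i1 e1] := fexpw C p mC C0 Cle0 (CE p p0).
  have [i2 e2] := fexpw heaviside p mone one0 onele0 (integral_expw_heaviside p p0).
  rewrite -(subrr p^-1%R) -[X in (X - _)%R]e1 -e2 -RintegralB//.
  by apply: eq_Rintegral => t; rewrite inE/= in_itv/= andbT => t0; rewrite hE.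
(* Uniqueness only identifies [fine (C t)]; finiteness of the weighted integral recovers [C t]
   itself almost everywhere. *)
have Cfin : {ae mu, forall t, C t \is a fin_num}.
  have i1 : mu.-integrable setT (expw 1%R C).
    apply/integrableP; split; first exact: measurable_expw.
    under eq_integral do rewrite gee0_abs ?expw_ge0//.
    by rewrite CE// ltry.
  have := integrable_ae measurableT i1.
  apply: ae_impl => t /(_ Logic.I); rewrite /expw.
  have := C0 t; case: (C t) => [r||]//.
  by rewrite gt0_muley// lte_fin expR_gt0.
apply: ae_impl2 Cfin (laplace0_ae0 h lh lh0) => t Ct ht.
have [t0|t0] := ltP 0%R t; last by rewrite -/C Cle0// onele0.
rewrite -/C -(fineK Ct) /heaviside /causal t0 max_l//.
by move: (ht t0) => /eqP; rewrite subr_eq0 => /eqP ->.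
Qed.

Let V := causal varkappa.
Let K := causal k.

Lemma measurable_causalK : measurable_fun setT K.
Proof. by apply: measurable_causal; exact: laplace_exists_measurable (lk _ ltr01). Qed.

Lemma measurable_causalV : measurable_fun setT V.
Proof. by apply: measurable_causal; exact: laplace_exists_measurable (lv _ ltr01). Qed.

(* An identity at every t, because Tonelli needs no integrability. *)
Lemma conv_VK F t : measurable_fun setT F -> (forall x, 0 <= F x) ->
  conv V (conv K F) t = conv heaviside F t.
Proof.
move=> mF F0; rewrite convA//; [|exact: measurable_causalV|exact: measurable_causalK|
  exact: causal_ge0..].
by apply: eq_conv; [exact: sonine_conv|exact: aeW].
Qed.

Lemma conv_KV F t : measurable_fun setT F -> (forall x, 0 <= F x) ->
  conv K (conv V F) t = conv heaviside F t.
Proof.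
move=> mF F0; rewrite convA//; [|exact: measurable_causalK|exact: measurable_causalV|
  exact: causal_ge0..].
apply: eq_conv; last exact: aeW.
apply: ae_impl sonine_conv => s <-.
by apply: convC; [exact: measurable_causalK|exact: measurable_causalV|
  exact: causal_ge0..].
Qed.

Let kcausal0 : {ae mu, forall s, (0 < s)%R -> (0 <= k s)%R}.
Proof. exact: aeW. Qed.

Lemma Ik0 f : Ik varkappa f 0 = 0%R.
Proof. by rewrite /Ik /kconv set_itv1 Rintegral_set1. Qed.

Lemma DkIk (f : R -> R) : measurable_fun (`]0%R, +oo[ : set R) f -> loc_bounded f ->
  {ae mu, forall t : R, (0 < t)%R ->
    derivable (kconv k (Ik varkappa f)) t 1 /\ Dk k (Ik varkappa f) t = f t}.
Proof.
move=> mf bf.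
have mNf : measurable_fun (`]0%R, +oo[ : set R) (\- f)%R by exact: measurableT_comp.
pose F1 := causal f; pose F2 := causal (\- f)%R.
have mF1 : measurable_fun setT F1 by exact: measurable_causal.
have mF2 : measurable_fun setT F2 by exact: measurable_causal.
have F10 : forall s, 0 <= F1 s by exact: causal_ge0.
have F20 : forall s, 0 <= F2 s by exact: causal_ge0.
have mV := measurable_causalV; have V0 : forall s, 0 <= V s by exact: causal_ge0.
have one0 : forall s, 0 <= heaviside s by exact: causal_ge0.
(* Only the values of [F] up to [t] enter the convolution at [t], so a local bound on [f] gives
   finiteness at every [t]. *)
have convle (H F : R -> \bar R) (M t : R) : measurable_fun setT H ->
    (forall s, 0 <= H s) ->
    (forall s, (s <= 0)%R -> H s = 0) -> measurable_fun setT F ->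
    (forall s, 0 <= F s) -> (0 <= M)%R ->
    (forall s, (s <= t)%R -> F s <= M%:E * heaviside s) ->
    conv H F t <= M%:E * conv heaviside H t.
  move=> mH H0 Hle mF F0 M0 FM.
  rewrite (convC heaviside)//; last exact: measurable_heaviside.
  rewrite -convZr//; last exact: measurable_heaviside.
  apply: ge0_le_integral => //.
  - by move=> s _; exact: mule_ge0.
  - by apply: emeasurable_funM => //; exact: measurableT_comp mH (measurable_subl _).
  - apply: emeasurable_funM; first exact: measurableT_comp mH (measurable_subl _).
    by apply: emeasurable_funM => //; exact: measurable_heaviside.
  move=> s _; have [st|st] := leP s t; last by rewrite Hle ?mul0e// subr_le0 ltW.
  by apply: lee_wpmul2l => //; exact: FM.
have bnd t : exists2 M : R, (0 <= M)%R & forall s, (s <= t)%R ->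
    F1 s <= M%:E * heaviside s /\ F2 s <= M%:E * heaviside s.
  have [t0|t0] := ltP 0%R t; last first.
    exists 0%R => // s st; have s0 := le_trans st t0.
    by rewrite /F1 /F2 !causal_le0 ?mul0e.
  have [M HM] := bf t t0; exists (Num.max M 0%R); first by rewrite le_max lexx orbT.
  move=> s st; rewrite /F1 /F2 /heaviside /causal; case: ifPn => [s0|_]; last by rewrite mule0.
  have := HM s; rewrite s0 st => /(_ isT); rewrite ler_norml => /andP[h1 h2].
  have mM : (M <= Num.max M 0%R)%R by rewrite le_max lexx.
  rewrite [Num.max 1%R 0%R]max_l// mule1 !lee_fin !ge_max !le_max lexx !orbT !andbT h2/=.
  by rewrite lerNl h1.
have Voo t : conv heaviside V t < +oo by apply: conv_heaviside_causal_lty; exact: lv.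
have VFoo t : conv V F1 t < +oo /\ conv V F2 t < +oo.
  have [M M0 FM] := bnd t; split.
    apply: (le_lt_trans (convle V F1 M t _ _ _ _ _ _ _)) => //.
    - by move=> s; exact: causal_le0.
    - by move=> s /FM[].
    - by rewrite lte_mul_pinfty// lee_fin.
  apply: (le_lt_trans (convle V F2 M t _ _ _ _ _ _ _)) => //.
  - by move=> s; exact: causal_le0.
  - by move=> s /FM[].
  - by rewrite lte_mul_pinfty// lee_fin.
have oneoo t : conv heaviside heaviside t < +oo.
  have [t0|t0] := ltP 0%R t; last first.
    by rewrite conv_le0 ?ltry// => s; exact: causal_le0.
  rewrite conv_heaviside integral_mkcond.
  apply: (@le_lt_trans _ _ (mu `]0%R, t])); last first.
    by rewrite lebesgue_measure_itv/= lte_fin t0 -EFinB ltry.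
  rewrite -[leRHS]mul1e -integral_cst// [leRHS]integral_mkcond le_eqVlt; apply/orP; left.
  apply/eqP/eq_integral => s _; rewrite !patchE !mem_setE !in_itv/= /heaviside /causal.
  by case: ltP => //= _; case: ifP => // _; rewrite max_l.
have oneFoo t : conv heaviside F1 t < +oo /\ conv heaviside F2 t < +oo.
  have mone := measurable_heaviside; have [M M0 FM] := bnd t; split.
    apply: (le_lt_trans (convle heaviside F1 M t _ _ _ _ _ _ _)) => //.
    - by move=> s; exact: causal_le0.
    - by move=> s /FM[].
    - by rewrite lte_mul_pinfty// lee_fin.
  apply: (le_lt_trans (convle heaviside F2 M t _ _ _ _ _ _ _)) => //.
  - by move=> s; exact: causal_le0.
  - by move=> s /FM[].
  - by rewrite lte_mul_pinfty// lee_fin.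
have finVF t : conv V F1 t \is a fin_num /\ conv V F2 t \is a fin_num.
  by have [? ?] := VFoo t; rewrite !ge0_fin_numE// conv_ge0.
have IkE s : Ik varkappa f s = (fine (conv V F1 s) - fine (conv V F2 s))%R.
  apply: kconvE => //; [exact: laplace_exists_measurable (lv _ ltr01)|
    by move=> ?; exact: causal_le0|by move=> ?; exact: causal_le0|
    exact: (VFoo s).1|exact: (VFoo s).2|].
  apply: aeW => r /andP[r0 _]; rewrite !causal_fin_num; split => //.
  rewrite /F1 /F2 /causal r0/=.
  by rewrite subr_max0.
(* This holds at every [t], not just almost everywhere, so the left-hand side can be differentiated
   as a primitive. *)
have kE t : kconv k (Ik varkappa f) t =
    (fine (\int[mu]_(x in `]-oo, t]) F1 x) - fine (\int[mu]_(x in `]-oo, t]) F2 x))%R.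
  have [foo1 foo2] := oneFoo t.
  have e1 := conv_KV F1 t mF1 F10; have e2 := conv_KV F2 t mF2 F20.
  rewrite -!conv_heaviside -e1 -e2; apply: kconvE => //.
  - exact: laplace_exists_measurable (lk _ ltr01).
  - exact: measurable_conv.
  - exact: measurable_conv.
  - by move=> s; exact: conv_ge0.
  - by move=> s; exact: conv_ge0.
  - by move=> s; apply: conv_le0 => ?; exact: causal_le0.
  - by move=> s; apply: conv_le0 => ?; exact: causal_le0.
  - by rewrite -/K e1.
  - by rewrite -/K e2.
  - by apply: aeW => s _; have [? ?] := finVF s; split => //; exact: IkE.
have main : forall n : nat, {ae mu, forall t : R, (t < n%:R)%R -> (0 < t)%R ->
    derivable (kconv k (Ik varkappa f)) t 1 /\ Dk k (Ik varkappa f) t = f t}.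
  move=> n; have [foo1 foo2] := oneFoo n%:R; rewrite !conv_heaviside in foo1 foo2.
  have := ae_derive_integralB _ _ _ _ mF1 mF2 F10 F20 foo1 foo2 (fun t _ => kE t).
  apply: ae_impl => t H tn t0; have [|dF FE] := H; first by rewrite t0.
  (* The boundary term of [Dk] drops out because [Ik varkappa f] vanishes at [0]. *)
  split => //; rewrite /Dk FE Ik0 mulr0 subr0 /F1 /F2 /causal t0/=.
  by rewrite subr_max0.
exact: (ae_lt_natr (fun t => (0 < t)%R -> _) main).
Qed.

Lemma IkDk (u : R -> R) (t : R) : abs_cont_nonneg u -> (0 <= t)%R ->
  Ik varkappa (Dk k u) t = (u t - u 0)%R.
Proof.
move=> uac; rewrite le_eqVlt => /predU1P[<-|t0]; first by rewrite Ik0 subrr.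
(* Any horizon beyond [t] would do: the representation of [u] and the derivative are needed on all
   of $(0,t)$. *)
pose T := (t + 1)%R; have T0 : (0 < T)%R by rewrite addr_gt0.
have tT : (t < T)%R by rewrite ltrDl.
have [W1 [W2 [[mW1 mW2] [W10 W20] Wle [W1oo W2oo] uE]]] :=
  abs_cont_integral R u T T0 (uac T T0).
have mK := measurable_causalK; have mV := measurable_causalV.
have K0 : forall s, 0 <= K s by exact: causal_ge0.
have V0 : forall s, 0 <= V s by exact: causal_ge0.
have mone := measurable_heaviside.
have one0 : forall s, 0 <= heaviside s by exact: causal_ge0.
have onele s : (s <= 0)%R -> heaviside s = 0 by exact: causal_le0.
have Kle s : (s <= 0)%R -> K s = 0 by exact: causal_le0.
have Koo s : conv heaviside K s < +oo by apply: conv_heaviside_causal_lty; exact: lk.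
(* On $(0,T)$, [u] is [U W1 (u 0)] minus [U W2 (- u 0)], the constant being split by sign. [QU]
   below says that [Q] is the density of [conv K (U W c)]. *)
pose Q (W : R -> \bar R) (c : R) s := conv K W s + (Num.max c 0%R)%:E * K s.
pose U (W : R -> \bar R) (c : R) s :=
  conv heaviside W s + (Num.max c 0%R)%:E * heaviside s.
have max0 (c : R) : (0 <= Num.max c 0)%R by rewrite le_max lexx orbT.
have QU (W : R -> \bar R) c s : measurable_fun setT W -> (forall x, 0 <= W x) ->
    conv K (U W c) s = conv heaviside (Q W c) s.
  move=> mW W0; rewrite /U /Q.
  have mKW := measurable_conv _ _ mK mW K0 W0.
  have moW := measurable_conv _ _ mone mW one0 W0.
  have mcK : measurable_fun setT (fun s => (Num.max c 0%R)%:E * K s).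
    exact: emeasurable_funM.
  have mco : measurable_fun setT (fun s => (Num.max c 0%R)%:E * heaviside s).
    exact: emeasurable_funM.
  have max0E : 0 <= (Num.max c 0%R)%:E :> \bar R by rewrite lee_fin.
  have KW0 x : 0 <= conv K W x by exact: conv_ge0.
  have oW0 x : 0 <= conv heaviside W x by exact: conv_ge0.
  have cK0 x : 0 <= (Num.max c 0%R)%:E * K x by exact: mule_ge0.
  have co0 x : 0 <= (Num.max c 0%R)%:E * heaviside x by exact: mule_ge0.
  rewrite (convDr K (conv heaviside W))// (convDr heaviside (conv K W))//.
  have -> : conv K (fun s => (Num.max c 0%R)%:E * heaviside s) s =
      (Num.max c 0%R)%:E * conv K heaviside s by apply: convZr.
  have -> : conv heaviside (fun s => (Num.max c 0%R)%:E * K s) s =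
      (Num.max c 0%R)%:E * conv heaviside K s by apply: convZr.
  have Kone x : conv K heaviside x = conv heaviside K x by apply: convC.
  have -> : conv K (conv heaviside W) s = conv heaviside (conv K W) s.
    transitivity (conv (conv K heaviside) W s); first by apply: convA.
    transitivity (conv (conv heaviside K) W s); last by apply/esym; apply: convA.
    by apply: eq_conv; apply: aeW.
  by rewrite Kone.
have mQ (W : R -> \bar R) c : measurable_fun setT W -> (forall x, 0 <= W x) ->
    measurable_fun setT (Q W c).
  move=> mW W0; apply: emeasurable_funD; first exact: measurable_conv.
  exact: emeasurable_funM.
have mU (W : R -> \bar R) c : measurable_fun setT W -> (forall x, 0 <= W x) ->
    measurable_fun setT (U W c).
  move=> mW W0; apply: emeasurable_funD; first exact: measurable_conv.
  exact: emeasurable_funM.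
have Q0 (W : R -> \bar R) c : (forall x, 0 <= W x) -> forall s, 0 <= Q W c s.
  move=> W0 s; rewrite adde_ge0 ?conv_ge0// mule_ge0// lee_fin//.
have U0 (W : R -> \bar R) c : (forall x, 0 <= W x) -> forall s, 0 <= U W c s.
  move=> W0 s; rewrite adde_ge0 ?conv_ge0// mule_ge0// lee_fin//.
(* Reassociate and use that the primitive of [K] is nondecreasing: its value at [s] times the
   integral of [W] is a finite bound. *)
have KWoo (W : R -> \bar R) s : measurable_fun setT W -> (forall x, 0 <= W x) ->
    (forall x, (x <= 0)%R -> W x = 0) -> \int[mu]_x W x < +oo ->
    conv heaviside (conv K W) s < +oo.
  move=> mW W0 Wz Woo; rewrite convA//.
  have oK0 : 0 <= conv heaviside K s by exact: conv_ge0.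
  have finK : conv heaviside K s \is a fin_num by rewrite ge0_fin_numE.
  apply: (@le_lt_trans _ _ ((fine (conv heaviside K s))%:E * \int[mu]_x W x)).
    apply: conv_le_cst => //.
    - exact: measurable_conv.
    - by move=> x; exact: conv_ge0.
    - exact: fine_ge0.
    - by move=> x xs; rewrite fineK//; exact: le_conv_heaviside.
  by rewrite lte_mul_pinfty// lee_fin fine_ge0.
have Qoo (W : R -> \bar R) c s : measurable_fun setT W -> (forall x, 0 <= W x) ->
    (forall x, (x <= 0)%R -> W x = 0) -> \int[mu]_x W x < +oo ->
    conv heaviside (Q W c) s < +oo.
  move=> mW W0 Wz Woo; rewrite /Q convDr//.
  - rewrite convZr// lte_add_pinfty ?KWoo// lte_mul_pinfty// lee_fin//.
  - exact: measurable_conv.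
  - exact: emeasurable_funM.
  - by move=> x; exact: conv_ge0.
  - by move=> x; rewrite mule_ge0// lee_fin.
have W1z x : (x <= 0)%R -> W1 x = 0 by move=> /Wle[].
have W2z x : (x <= 0)%R -> W2 x = 0 by move=> /Wle[].
have oneWfin (W : R -> \bar R) s : measurable_fun setT W -> (forall x, 0 <= W x) ->
    \int[mu]_x W x < +oo -> conv heaviside W s \is a fin_num.
  move=> mW W0 Woo; rewrite ge0_fin_numE ?conv_ge0// conv_heaviside.
  by apply: le_lt_trans Woo; apply: ge0_subset_integral.
have kcu s : (0 < s < T)%R -> kconv k u s =
    (fine (\int[mu]_(x in `]-oo, s]) Q W1 (u 0%R) x) -
     fine (\int[mu]_(x in `]-oo, s]) Q W2 (- u 0)%R x))%R.
  move=> /andP[s0 sT]; rewrite -!conv_heaviside -!QU//; apply: kconvE => //.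
  - exact: laplace_exists_measurable (lk _ ltr01).
  - exact: mU.
  - exact: mU.
  - exact: U0.
  - exact: U0.
  - by move=> x x0; rewrite /U onele// mule0 adde0 conv_le0.
  - by move=> x x0; rewrite /U onele// mule0 adde0 conv_le0.
  - by rewrite -/K QU// Qoo.
  - by rewrite -/K QU// Qoo.
  apply: aeW => x /andP[x0 xs].
  have f1 := oneWfin W1 x mW1 W10 W1oo; have f2 := oneWfin W2 x mW2 W20 W2oo.
  have xT : (0 <= x <= T)%R by rewrite (ltW x0) ltW// (lt_trans xs).
  have one1 : heaviside x = 1 by rewrite /heaviside /causal x0 max_l.
  rewrite /U one1 !mule1; split; [by rewrite fin_numD f1|by rewrite fin_numD f2|].
  rewrite (uE x xT) -!conv_heaviside (fineD f1)// (fineD f2)//=.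
  move: (subr_max0 (u 0%R)).
  by move: (Num.max (u 0%R) 0%R) (Num.max (- u 0%R)%R 0%R) => a1 a2 <-; ring.
have q1 := Qoo W1 (u 0%R) T mW1 W10 W1z W1oo; rewrite conv_heaviside in q1.
have q2 := Qoo W2 (- u 0)%R T mW2 W20 W2z W2oo; rewrite conv_heaviside in q2.
have D := ae_derive_integralB _ _ _ T (mQ _ _ mW1 W10) (mQ _ _ mW2 W20)
  (Q0 _ _ W10) (Q0 _ _ W20) q1 q2 kcu.
have KWfin (W : R -> \bar R) : measurable_fun setT W -> (forall x, 0 <= W x) ->
    (forall x, (x <= 0)%R -> W x = 0) -> \int[mu]_x W x < +oo ->
    {ae mu, forall x, (x <= T)%R -> conv K W x \is a fin_num}.
  move=> mW W0 Wz Woo; have := KWoo W T mW W0 Wz Woo; rewrite conv_heaviside => oo.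
  have i : mu.-integrable `]-oo, T] (conv K W).
    apply/integrableP; split.
      by apply: measurable_funTS; exact: measurable_conv.
    by under eq_integral do rewrite gee0_abs ?conv_ge0//.
  have := integrable_ae _ i; move=> /(_ (measurable_itv _)).
  by apply: ae_impl => x + xT; apply; rewrite /= in_itv.
have cW1 : conv V (conv K W1) t = conv heaviside W1 t by exact: conv_VK.
have cW2 : conv V (conv K W2) t = conv heaviside W2 t by exact: conv_VK.
(* [Dk k u] is known only almost everywhere, which [kconvE] accepts; the convolutions with [V] are
   finite at this very [t] by [conv_VK]. *)
have -> : Ik varkappa (Dk k u) t =
    (fine (conv V (conv K W1) t) - fine (conv V (conv K W2) t))%R.
  apply: kconvE => //.
  - exact: laplace_exists_measurable (lv _ ltr01).
  - exact: measurable_conv.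
  - exact: measurable_conv.
  - by move=> x; exact: conv_ge0.
  - by move=> x; exact: conv_ge0.
  - by move=> x x0; exact: conv_le0.
  - by move=> x x0; exact: conv_le0.
  - by rewrite -/V cW1 -ge0_fin_numE ?conv_ge0// oneWfin.
  - by rewrite -/V cW2 -ge0_fin_numE ?conv_ge0// oneWfin.
  apply: ae_impl2 D (ae_and (KWfin W1 mW1 W10 W1z W1oo) (KWfin W2 mW2 W20 W2z W2oo)).
  move=> s Ds [f1 f2] /andP[s0 st]; have sT := lt_trans st tT.
  have [|_ DE] := Ds; first by rewrite s0.
  have g1 := f1 (ltW sT); have g2 := f2 (ltW sT); split => //.
  have KE : K s = (k s)%:E by rewrite /K causalE// k0.
  (* The boundary term [k s * u 0] cancels the two multiples of [K s], since the positive parts of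
     [u 0] and [- u 0] differ by [u 0]. *)
  rewrite /Dk DE /Q KE -!EFinM (fineD g1)// (fineD g2)//=.
  move: (subr_max0 (u 0%R)).
  by move: (Num.max (u 0%R) 0%R) (Num.max (- u 0%R)%R 0%R) => a1 a2 <-; ring.
rewrite cW1 cW2 uE ?(ltW t0) ?(ltW tT)// -!conv_heaviside; ring.
Qed.

End Pair.
End Sonine.

Theorem theorem1 (R : realType) (k varkappa : R -> R) :
  (forall t : R, 0 < t -> 0 <= k t) ->
  loc_integrable k ->
  (forall p : R, 0 < p -> laplace_exists k p) ->
  stieltjes (laplace k) ->
  laplace k p @[p --> 0^'+] --> +oo ->
  laplace k p @[p --> +oo] --> 0 ->
  p * laplace k p @[p --> 0^'+] --> 0 ->
  p * laplace k p @[p --> +oo] --> +oo ->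
  (* varkappa: the kernel whose Laplace transform is 1 / (p * laplace k p) *)
  (forall p : R, 0 < p -> laplace_exists varkappa p) ->
  (forall p : R, 0 < p -> laplace varkappa p = (p * laplace k p)^-1) ->
  (* (i) *)
  (forall f : R -> R,
     measurable_fun (`]0%R, +oo[ : set R) f -> loc_bounded f ->
     {ae (@lebesgue_measure R), forall t : R, 0 < t ->
        derivable (kconv k (Ik varkappa f)) t 1 /\
        Dk k (Ik varkappa f) t = f t})
  /\
  (* (ii) *)
  (forall u : R -> R, abs_cont_nonneg u ->
     forall t : R, 0 <= t -> Ik varkappa (Dk k u) t = u t - u 0).
Proof.
move=> k0 _ lk sk _ _ _ koo lv vE.
have kp := laplace_gt0 k k0 lk koo.
have v0 := sonine_dual_ge0 k varkappa sk kp lv vE.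
split; first exact: DkIk.
move=> u uac t t0.
by apply: IkDk.
Qed.
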